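(* In the setting described in the context, assume that for $\ell$-almost every $t$ the operator $H_t$ is positive semi-definite on $L_{2,t}$ (i.e. $\langle H_tf,f\rangle_{L_{2,t}}\ge0$ for all $f\in L_{2,t}$), and that $\lim_{k\to\infty}\beta_k=0$. Then for every $k\in\mathbb N$, \[ \frac{\mathrm{gap}(U)-\beta_k}{k}\le \mathrm{gap}(H)\le \mathrm{gap}(U). \]
   Context: Let $K\subseteq\mathbb R^d$ be Borel and $\rho:K\to[0,\infty)$ measurable with $0<\int_K\rho\,\mathrm dx<\infty$; $\pi(A)=\int_A\rho\,\mathrm dx/\int_K\rho\,\mathrm dx$. For $t\ge0$, $K(t)=\{x\in K:\rho(x)\ge t\}$, assume $0<\mathrm{vol}_d(K(t))<\infty$ for $t\in(0,\|\rho\|_\infty)$, $U_t$ is the uniform distribution on $K(t)$, and $\ell(s)=\mathrm{vol}_d(K(s))/\int_0^\infty\mathrm{vol}_d(K(r))\,\mathrm dr$. For each $t$, $H_t$ is a Markov kernel on $K(t)$ (extended by $0$ outside $K(t)$, measurable in $(t,x)$), reversible with respect to $U_t$. $L_{2,\pi}=L_2(K,\pi)$, $L_{2,t}=L_2(K(t),U_t)$; $H_t$ acts on $L_{2,t}$ by $H_tf(x)=\int f(y)H_t(x,\mathrm dy)$ and $U_t$ acts by $f\mapsto U_t(f)=\int f\,\mathrm dU_t$. The hybrid slice sampler is $Hf(x)=\frac1{\rho(x)}\int_0^{\rho(x)}H_tf(x)\,\mathrm dt$ and the simple slice sampler is $Uf(x)=\frac1{\rho(x)}\int_0^{\rho(x)}U_t(f)\,\mathrm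 dt$, both on $L_{2,\pi}$. $S(f)=\int_Kf\,\mathrm d\pi$ as an operator onto constants, and $\mathrm{gap}(P)=1-\|P-S\|_{L_{2,\pi}\to L_{2,\pi}}$. Finally $\beta_k=\sup_{x\in K}\big(\int_0^{\rho(x)}\|H_t^k-U_t\|^2_{L_{2,t}\to L_{2,t}}\,\mathrm dt/\rho(x)\big)^{1/2}$. *)

(* Defs.v *)
From HB Require Import structures.
From mathcomp Require Import all_boot all_order all_algebra.
From mathcomp Require Import all_classical all_reals all_analysis measurable_realfun.
Set Implicit Arguments. Unset Strict Implicit. Unset Printing Implicit Defensive.
Import Order.TTheory GRing.Theory Num.Theory.
Local Open Scope classical_set_scope.
Local Open Scope ring_scope.

(* R^d is modelled as d.-tuple R with its canonical (product = Borel)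
   sigma-algebra.  The library has no Lebesgue measure on R^d, so we
   characterise it: a measure giving every half-open box
   {x | a_i < x_i <= b_i} its volume prod (b_i - a_i).  Half-open boxes form a
   pi-system generating the Borel sets and R^d is sigma-finite for such a
   measure, so this determines Lebesgue measure on Borel sets uniquely. *)
Definition is_lebesgue_Rd (R : realType) (d : nat)
  (vol : set (d.-tuple R) -> \bar R) : Prop :=
  forall a b : d.-tuple R, (forall i, tnth a i <= tnth b i) ->
    vol [set x | forall i, tnth a i < tnth x i <= tnth b i] =
    (\prod_(i < d) (tnth b i - tnth a i))%:E.

(* extended-real square root (only applied to nonnegative quantities) *)
Definition esqrt (R : realType) (x : \bar R) : \bar R :=
  match x with
  | r%:E => (Num.sqrt r)%:E
  | +oo%E => +oo%E
  | -oo%E => 0%E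
  end.

Section slice.
Context {R : realType} {d : nat}.
Local Notation T := (d.-tuple R).
Variables (vol : {measure set T -> \bar R}) (K : set T) (rho : T -> R).

Definition Klev (t : R) : set T := [set x | K x /\ t <= rho x].

Definition rho_sup : \bar R := ereal_sup [set (rho x)%:E | x in K].

Definition Zrho : \bar R := (\int[vol]_(x in K) (rho x)%:E)%E.

(* squared norm in L_2(K, pi), pi(dx) = rho(x) dx / Z *)
Definition normsq_pi (f : T -> R) : \bar R :=
  ((\int[vol]_(x in K) (f x ^+ 2 * rho x)%:E) * ((fine Zrho)^-1)%:E)%E.

Definition L2pi (f : T -> R) : Prop :=
  measurable_fun K f /\ (normsq_pi f < +oo)%E.

Definition opnorm_pi (A : (T -> R) -> (T -> R)) : \bar R :=
  ereal_sup [set esqrt (normsq_pi (A f)) | f in [set f | L2pi f /\ (normsq_pi f <= 1)%E]].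

Definition Sop (f : T -> R) : T -> R :=
  fun _ => fine (\int[vol]_(x in K) (f x * rho x)%:E)%E / fine Zrho.

Definition gap (P : (T -> R) -> (T -> R)) : \bar R :=
  (1 - opnorm_pi (fun f x => (P f x - Sop f x)%R))%E.

(* squared norm in L_2(K(t), U_t), U_t uniform on K(t) *)
Definition normsq_t (t : R) (f : T -> R) : \bar R :=
  ((\int[vol]_(x in Klev t) (f x ^+ 2)%:E) * ((fine (vol (Klev t)))^-1)%:E)%E.

Definition inner_t (t : R) (g f : T -> R) : \bar R :=
  ((\int[vol]_(x in Klev t) (g x * f x)%:E) * ((fine (vol (Klev t)))^-1)%:E)%E.

Definition L2t (t : R) (f : T -> R) : Prop :=
  measurable_fun (Klev t) f /\ (normsq_t t f < +oo)%E.

Definition opnorm_t (t : R) (A : (T -> R) -> (T -> R)) : \bar R :=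
  ereal_sup [set esqrt (normsq_t t (A f)) | f in [set f | L2t t f /\ (normsq_t t f <= 1)%E]].

Definition Ut (t : R) (f : T -> R) : R :=
  fine (\int[vol]_(x in Klev t) (f x)%:E)%E / fine (vol (Klev t)).

Variable H : R -> T -> {measure set T -> \bar R}.

Definition Hop (t : R) (f : T -> R) : T -> R :=
  fun x => fine (\int[H t x]_y (f y)%:E)%E.

Definition Hslice (f : T -> R) : T -> R :=
  fun x => fine (\int[@lebesgue_measure R]_(t in [set s : R | (0 < s < rho x)%R]) (Hop t f x)%:E)%E / rho x.

Definition Uslice (f : T -> R) : T -> R :=
  fun x => fine (\int[@lebesgue_measure R]_(t in [set s : R | (0 < s < rho x)%R]) (Ut t f)%:E)%E / rho x.

Definition beta (k : nat) : \bar R :=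
  ereal_sup [set esqrt
     ((\int[@lebesgue_measure R]_(t in [set s : R | (0 < s < rho x)%R])
         (opnorm_t t (fun f y => (iter k (Hop t) f y - Ut t f)%R)
          * opnorm_t t (fun f y => (iter k (Hop t) f y - Ut t f)%R)))
      * ((rho x)^-1)%:E)%E | x in K].

(* "for ell-almost every t": ell(ds) proportional to vol(K(s)) ds on [0,oo);
   a set N is ell-null iff int_N vol(K(s)) ds = 0 *)
Definition ell_ae (P : R -> Prop) : Prop :=
  exists N : set R, [/\ measurable N, N `<=` [set s | 0 <= s],
    (\int[@lebesgue_measure R]_(s in N) vol (Klev s))%E = 0%E &
    [set t | 0 <= t /\ ~ P t] `<=` N].

Definition psd_t (t : R) : Prop :=
  forall f, L2t t f -> (0 <= inner_t t (Hop t f) f)%E.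

End slice.

(* Main.v *)
Require Import Defs.
From HB Require Import structures.
From mathcomp Require Import all_boot all_order all_algebra.
From mathcomp Require Import all_classical all_reals all_analysis measurable_realfun.
From mathcomp Require Import ring lra.
Set Implicit Arguments. Unset Strict Implicit. Unset Printing Implicit Defensive.
Import Order.TTheory GRing.Theory Num.Theory.
Local Open Scope classical_set_scope.
Local Open Scope ring_scope.

(** Let [M] be Lebesgue measure on [R * R^d] restricted to the region
    [{(t, x) | 0 < t <= rho x}] under the graph of [rho]; up to the factor
    [Z = int rho] its marginal in [x] is [pi] and its fibre at level [t] is [U_t].
    On [L2 M], let [P] and [U] act fibrewise by [H_t] and [U_t], and let [V]
    average over [0 < t < rho x]; then the hybrid and the simple slice sampler
    are [f |-> V (P (f \o snd))] and [f |-> V (U (f \o snd))], and [V] is adjoint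
    to [f |-> f \o snd].
    - Upper bound: [P] is positive, symmetric and fixes the range of the
      projection [U], hence [<U f, f> <= <P f, f>].  Both centered forms
      [<P f, g> - (int f)(int g) / Z] and [<U f, g> - (int f)(int g) / Z] are
      positive, and by Cauchy-Schwarz the norm of a sampler minus [S] is the
      supremum of its centered form on unit vectors.
    - Lower bound: the moments [a_j = <P^j f, f>] are convex in [j], so
      [k (a_0 - a_1) >= a_0 - a_k], whereas [a_k <= <U f, f> + beta_k |f|^2]. *)

(** Gluing the kernels [H_t] into one kernel on the product that moves only the second coordinate
    gives a single kernel reversible for [M], so contraction, symmetry and moments are proved once,
    for abstract reversible kernels. Every operator takes [fine] of an integral, and the integrand
    need not be integrable at each point, so linearity holds only almost everywhere. Linearity,
    idempotence and fixed points are therefore stated after pairing with a test function. The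
    estimate of [a_k] rests on integrating over the region in both orders. The norm of [H_t^k - U_t]
    depends on [t] alone and [f \o snd] on [x] alone: a bound found at fixed [t] can be integrated
    over [t] first, at fixed [x], and this is the integral that [beta_k] controls uniformly in [x].
    Elements of L_2(pi) are constrained on [K] only, hence the extensions by 0 wherever they are
    lifted to the product. *)

(* [f] is arbitrary in these lemmas because [Hop] integrates over the whole space
   functions that are only measurable on [K] or [K(t)]. *)
Section nonmeasurable_integral.
Local Open Scope ereal_scope.
Context d (X : measurableType d) (R : realType).
Import HBNNSimple.

Lemma sintegral_mrestr (mu : {measure set X -> \bar R}) (D : set X)
    (mD : measurable D) (h : {nnsfun X >-> R}) :
  sintegral (mrestr mu mD) h = sintegral mu (h \_ D).
Proof.
rewrite (mrestrict h mD) !sintegralEnnsfun.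
apply: eq_fsbigr => r; rewrite inE /= => r0.
congr (_ * _); rewrite /mrestr; congr (mu _).
rewrite -mrestrict; apply/seteqP; split => x /=.
  by move=> [hx Dx]; rewrite patchT// inE.
by rewrite /patch; case: ifPn => [/[!inE] //|_ r0']; rewrite -r0' ltxx in r0.
Qed.

(** For nonnegative integrands both sides are suprema over simple functions below the integrand.
    Restricting to [D] maps one family into the other; conversely, a simple function below [g \_ D]
    already vanishes off [D]. *)
Lemma integral_mrestr (mu : {measure set X -> \bar R}) (D : set X)
    (mD : measurable D) (f : X -> \bar R) :
  \int[mrestr mu mD]_x f x = \int[mu]_(x in D) f x.
Proof.
have ge0E g : (forall x, 0 <= g x) ->
    \int[mrestr mu mD]_x g x = \int[mu]_(x in D) g x.
  move=> g0; rewrite ge0_integralTE// ge0_integralE//.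
  apply/eqP; rewrite eq_le; apply/andP; split.
  - apply: ge_ereal_sup => _ [h hg <-]; rewrite sintegral_mrestr.
    apply: ereal_sup_ubound; exists (proj_nnsfun h mD) => /=; last first.
      by rewrite -mrestrict.
    move=> x; have := congr1 (@^~ x) (mrestrict h mD); rewrite /= => <-.
    by rewrite /patch; case: ifPn.
  - apply: ge_ereal_sup => _ [h hg <-].
    have hD : (h : X -> R) = h \_ D.
      apply/funext => x; rewrite /patch; case: ifPn => // xD.
      have := hg x; rewrite /patch (negbTE xD) lee_fin => hx.
      by apply: le_anti; rewrite hx fun_ge0.
    rewrite [in X in X <= _]hD -sintegral_mrestr.
    apply: ereal_sup_ubound; exists h => //= x.
    by apply: (le_trans (hg x)); rewrite /patch; case: ifPn.
by rewrite [LHS]integralE [RHS]integralE !ge0E.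
Qed.

Lemma integral_concentrated (mu : {measure set X -> \bar R}) (D : set X)
    (f : X -> \bar R) : measurable D -> mu (~` D) = 0 ->
  \int[mu]_x f x = \int[mu]_(x in D) f x.
Proof.
move=> mD mu0; rewrite -(integral_mrestr mu mD).
apply: eq_measure_integral => A mA _; rewrite /= /mrestr.
rewrite -[in LHS](setIT A) -(setUv D) setIUr measureU//=; first last.
- by rewrite setIACA setICr setI0.
- by apply: measurableI => //; exact: measurableC.
- exact: measurableI.
rewrite -[RHS]adde0; congr (_ + _).
apply/eqP; rewrite eq_le measure_ge0 andbT -mu0.
by apply: le_measure; rewrite ?inE//; [apply: measurableI => //|]; exact: measurableC.
Qed.

Lemma ge0_le_integral_lower (mu : {measure set X -> \bar R}) (D : set X)
    (f g : X -> \bar R) : (forall x, D x -> 0 <= f x) ->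
  (forall x, D x -> f x <= g x) ->
  \int[mu]_(x in D) f x <= \int[mu]_(x in D) g x.
Proof.
move=> f0 fg; rewrite !ge0_integralE//; last first.
  by move=> x Dx; exact: le_trans (f0 _ Dx) (fg _ Dx).
apply: ge_ereal_sup => _ [h hf <-]; apply: ereal_sup_ubound; exists h => // x.
apply: (le_trans (hf x)); rewrite /patch; case: ifPn => // /[!inE] Dx.
exact: fg.
Qed.

End nonmeasurable_integral.

(** * Induction on nonnegative measurable functions *)

Section induction_principle.
Local Open Scope ereal_scope.
Context d (X : measurableType d) (R : realType).
Import HBNNSimple.

Lemma ge0_measurable_ind (P : (X -> \bar R) -> Prop) :
  (forall A, measurable A -> P (fun x => (\1_A x)%:E)) ->
  (forall r f, (0 <= r)%R -> measurable_fun setT f -> (forall x, 0 <= f x) ->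
     P f -> P (fun x => r%:E * f x)) ->
  (forall f g, measurable_fun setT f -> (forall x, 0 <= f x) ->
     measurable_fun setT g -> (forall x, 0 <= g x) -> P f -> P g ->
     P (fun x => f x + g x)) ->
  (forall (u : (X -> \bar R)^nat) f, (forall n, measurable_fun setT (u n)) ->
     (forall n x, 0 <= u n x) -> (forall x, nondecreasing_seq (u ^~ x)) ->
     (forall x, u n x @[n --> \oo] --> f x) -> (forall n, P (u n)) -> P f) ->
  forall f, measurable_fun setT f -> (forall x, 0 <= f x) -> P f.
Proof.
move=> P1 PZ PD Plim f mf f0.
pose h := nnsfun_approx measurableT mf.
have Psum (s : seq R) (g : {nnsfun X >-> R}) :
    P (fun x => \sum_(r <- s) r%:E * (\1_(g @^-1` [set r]) x)%:E).
  elim: s => [|r s IH].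
    rewrite (_ : (fun _ => _) = (fun x => (\1_(@set0 X) x)%:E)); first exact: P1.
    by apply/funext => x; rewrite big_nil indic0.
  rewrite (_ : (fun _ => _) = (fun x => r%:E * (\1_(g @^-1` [set r]) x)%:E +
     \sum_(r <- s) r%:E * (\1_(g @^-1` [set r]) x)%:E)); last first.
    by apply/funext => x; rewrite big_cons.
  have mI r' : measurable_fun setT (fun x => r'%:E * (\1_(g @^-1` [set r']) x)%:E).
    apply: measurable_funeM; apply/measurable_EFinP.
    exact: measurable_indic.
  have I0 r' x : 0 <= r'%:E * (\1_(g @^-1` [set r']) x)%:E.
    exact: nnfun_muleindic_ge0.
  apply: PD => //.
  - by apply: emeasurable_sum.
  - by move=> x; apply: sume_ge0.
  (* Scaling is assumed for nonnegative factors only; a negative [r] has empty preimage under the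
     nonnegative [g], so its summand is 0. *)
  - have [r0|r0] := leP 0%R r.
      apply: (PZ r (fun x => (\1_(g @^-1` [set r]) x)%:E)) => //.
      - by apply/measurable_EFinP; exact: measurable_indic.
      - exact: P1.
    rewrite (_ : (fun _ => _) = (fun x => (\1_(@set0 X) x)%:E)); first exact: P1.
    by apply/funext => x; rewrite preimage_nnfun0// !indic0 mule0.
apply: (Plim (fun n x => (h n x)%:E)).
- by move=> n; apply/measurable_EFinP.
- by move=> n x; rewrite lee_fin.
- by move=> x m n mn; rewrite lee_fin; exact/lefP/nd_nnsfun_approx.
- by move=> x; exact: cvg_nnsfun_approx.
- move=> n.
  rewrite (_ : (fun _ => _) = (fun x => \sum_(r <- finmap.enum_fset (fset_set (range (h n))))
    r%:E * (\1_(h n @^-1` [set r]) x)%:E)); first exact: Psum.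
  apply/funext => x; rewrite {1}(fimfunE (h n) x).
  rewrite fsbig_finite//= -sumEFin; apply: eq_bigr => r _.
  by rewrite EFinM.
Qed.

End induction_principle.

(** * Degenerate inner products and Cauchy-Schwarz *)

Section lincomb.
Context (X : Type) (R : realType).

Definition lincomb (a : R) (f g : X -> R) : X -> R := fun x => a * f x + g x.

Variables (L : (X -> R) -> Prop) (q : (X -> R) -> (X -> R) -> R).

(** The form is abstract and may be degenerate, so that one Cauchy-Schwarz inequality serves both
    the L2 product and the centered form of an operator. *)
Definition semi_inner : Prop :=
  [/\ forall a f g, L f -> L g -> L (lincomb a f g),
      forall f g, L f -> L g -> q f g = q g f,
      forall a f g h, L f -> L g -> L h ->
        q (lincomb a f g) h = a * q f h + q g h &
      forall f, L f -> 0 <= q f f].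

Lemma semi_inner_cauchy_schwarz f g : semi_inner -> L f -> L g ->
  q f g ^+ 2 <= q f f * q g g.
Proof.
move=> [Llin qC qlin q0] Lf Lg.
have quad a : 0 <= a ^+ 2 * q f f + 2 * a * q f g + q g g.
  have Lh := Llin a _ _ Lf Lg.
  have := q0 _ Lh; rewrite qlin// !(qC _ (lincomb _ _ _))// !qlin// (qC g f)//.
  by congr (_ <= _); ring.
have [ff0|ff0] := eqVneq (q f f) 0.
  have [->|fg0] := eqVneq (q f g) 0.
    by rewrite expr0n mulr_ge0// q0.
  (* With [q f f = 0] the quadratic is affine in [a], and this [a] gives it the value -1. *)
  have := quad (- (q g g + 1) / (2 * q f g)).
  rewrite ff0 (_ : _ + _ = -1); first by rewrite ler0N1.
  by field.
(* This [a] is the minimiser of the quadratic. *)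
have := quad (- q f g / q f f).
rewrite (_ : _ + _ = (q f f * q g g - q f g ^+ 2) / q f f); last by field.
rewrite pmulr_lge0 ?subr_ge0// invr_gt0 lt_neqAle eq_sym ff0/=.
exact: q0.
Qed.

End lincomb.

(** * Square-integrable functions for a finite measure *)

Section L2.
Context d (X : measurableType d) (R : realType).
Variable mu : {measure set X -> \bar R}.
Hypothesis mufin : (mu setT < +oo)%E.
Implicit Types f g h : X -> R.

Definition L2 f : Prop :=
  measurable_fun setT f /\ (\int[mu]_x (f x ^+ 2)%:E < +oo)%E.

Definition ip f g : R := \int[mu]_x (f x * g x).

Lemma measurable_lincomb a f g : measurable_fun setT f ->
  measurable_fun setT g -> measurable_fun setT (lincomb a f g).
Proof.
by move=> mf mg; apply: measurable_funD => //; apply: measurable_funM.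
Qed.

Lemma measurable_EFin_sqr f : measurable_fun setT f ->
  measurable_fun setT (fun x => (f x ^+ 2)%:E).
Proof. by move=> mf; apply/measurable_EFinP; exact: measurable_funX. Qed.

Lemma L2_integrable_mul f g : L2 f -> L2 g ->
  mu.-integrable setT (EFin \o (fun x => f x * g x)).
Proof.
move=> [mf f2] [mg g2]; apply/integrableP; split.
  by apply/measurable_EFinP; exact: measurable_funM.
apply: (@le_lt_trans _ _ (\int[mu]_x ((f x ^+ 2)%:E + (g x ^+ 2)%:E))%E).
  apply: ge0_le_integral_lower => // x _ /=.
  rewrite -EFinD lee_fin ler_norml.
  have := sqr_ge0 (f x + g x); have := sqr_ge0 (f x - g x).
  have := sqr_ge0 (f x); have := sqr_ge0 (g x).
  by move=> *; apply/andP; split; nra.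
rewrite ge0_integralD//; first exact: lte_add_pinfty.
- by move=> x _; rewrite lee_fin sqr_ge0.
- exact: measurable_EFin_sqr.
- by move=> x _; rewrite lee_fin sqr_ge0.
- exact: measurable_EFin_sqr.
Qed.

Lemma L2_cst c : L2 (cst c).
Proof.
split; first exact: measurable_cst.
rewrite (integral_cst mu measurableT (c ^+ 2)%:E).
by rewrite -ge0_fin_numE ?mule_ge0 ?lee_fin ?sqr_ge0// fin_numM// ge0_fin_numE.
Qed.

Lemma L2_integrable f : L2 f -> mu.-integrable setT (EFin \o f).
Proof.
move=> Lf; have := L2_integrable_mul Lf (L2_cst 1).
by congr (integrable _ _ _); apply/funext => x /=; rewrite mulr1.
Qed.

Lemma L2_le f g : measurable_fun setT f -> (forall x, f x ^+ 2 <= g x ^+ 2) ->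
  L2 g -> L2 f.
Proof.
move=> mf fg [mg g2]; split=> //; apply: le_lt_trans g2.
by apply: ge0_le_integral_lower => x _; rewrite lee_fin ?sqr_ge0.
Qed.

Lemma L2_lincomb a f g : L2 f -> L2 g -> L2 (lincomb a f g).
Proof.
move=> Lf Lg; have [[mf _] [mg _]] := (Lf, Lg); split.
  exact: measurable_lincomb.
have sqr_int h : L2 h -> mu.-integrable setT (EFin \o (fun x => h x ^+ 2)).
  by move=> Lh; have := L2_integrable_mul Lh Lh.
have i1 := integrableZl measurableT (a ^+ 2) (sqr_int _ Lf).
have i2 := integrableZl measurableT (2 * a) (L2_integrable_mul Lf Lg).
have i3 := integrableD measurableT (integrableD measurableT i1 i2) (sqr_int _ Lg).
have := integrable_lty measurableT i3; congr (_ < _)%E; apply: eq_integral => x _ /=.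
by rewrite -!EFinM -!EFinD /lincomb; congr EFin; ring.
Qed.

Lemma ipE f g : L2 f -> L2 g ->
  (ip f g)%:E = (\int[mu]_x (f x * g x)%:E)%E.
Proof.
move=> Lf Lg; rewrite /ip /Rintegral fineK//.
by have := integrable_fin_num measurableT (L2_integrable_mul Lf Lg).
Qed.

Lemma ipC f g : ip f g = ip g f.
Proof. by apply: eq_Rintegral => x _; rewrite mulrC. Qed.

Lemma ip_lincombl a f g h : L2 f -> L2 g -> L2 h ->
  ip (lincomb a f g) h = a * ip f h + ip g h.
Proof.
move=> Lf Lg Lh; rewrite /ip -RintegralZl//; last exact: L2_integrable_mul.
rewrite -RintegralD//; last exact: L2_integrable_mul.
  by apply: eq_Rintegral => x _; rewrite /lincomb; ring.
by have := integrableZl measurableT a (L2_integrable_mul Lf Lh).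
Qed.

Lemma ip_lincombr a f g h : L2 f -> L2 g -> L2 h ->
  ip h (lincomb a f g) = a * ip h f + ip h g.
Proof. by move=> *; rewrite ipC ip_lincombl// !(ipC h). Qed.

Lemma ip_ge0 f : 0 <= ip f f.
Proof. by apply: Rintegral_ge0 => x _; rewrite -expr2 sqr_ge0. Qed.

Lemma semi_inner_ip : semi_inner L2 ip.
Proof.
split => *; [exact: L2_lincomb|exact: ipC|exact: ip_lincombl|exact: ip_ge0].
Qed.

Lemma ip_ae_eql f g h : L2 f -> L2 g -> L2 h ->
  {ae mu, forall x, f x = g x} -> ip f h = ip g h.
Proof.
move=> Lf Lg Lh fg; rewrite /ip /Rintegral; congr fine.
have [[[mf _] [mg _]] [mh _]] := (Lf, Lg, Lh).
apply: ae_eq_integral => //.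
- by apply/measurable_EFinP; exact: measurable_funM.
- by apply/measurable_EFinP; exact: measurable_funM.
- by apply: filterS fg => x /= -> _.
Qed.

(** Cauchy-Schwarz against the constant 1. When the integral of [f ^+ 2] is infinite the right-hand
    side is [+oo], except for the null measure, where [0 * +oo = 0] and the left-hand side is 0 as
    well. *)
Lemma sqr_integral_le f : measurable_fun setT f ->
  ((fine (\int[mu]_x (f x)%:E) ^+ 2)%:E <= mu setT * \int[mu]_x (f x ^+ 2)%:E)%E.
Proof.
move=> mf.
have f20 : (0 <= \int[mu]_x (f x ^+ 2)%:E)%E.
  by apply: integral_ge0 => x _; rewrite lee_fin sqr_ge0.
have [mu0|mu0] := eqVneq (mu setT) 0%E.
  rewrite mu0 mul0e (_ : \int[mu]_x (f x)%:E = 0)%E ?expr0n//.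
  rewrite (@eq_measure_integral _ _ _ _ mzero) ?integral_measure_zero//.
  move=> A mA _; apply/eqP; rewrite eq_le measure_ge0 andbT.
  by apply: (@le_trans _ _ (mu setT)); [apply: le_measure; rewrite ?inE|rewrite mu0].
have [f2y|] := ltP (\int[mu]_x (f x ^+ 2)%:E)%E +oo%E; last first.
  rewrite leye_eq => /eqP ->.
  by rewrite gt0_muley ?leey// lt_neqAle eq_sym mu0/=.
have Lf : L2 f by split.
have := semi_inner_cauchy_schwarz semi_inner_ip Lf (L2_cst 1).
have -> : ip f (cst 1) = fine (\int[mu]_x (f x)%:E)%E.
  by apply: eq_Rintegral => x _; rewrite /= mulr1.
have -> : ip (cst 1) (cst 1) = fine (mu setT).
  rewrite /ip; under eq_Rintegral do rewrite /= mulr1.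
  by rewrite Rintegral_cst// mul1r.
have : (ip f f)%:E = (\int[mu]_x (f x ^+ 2)%:E)%E.
  by rewrite ipE//; apply: eq_integral => x _.
move=> <- cs; rewrite muleC -[X in (_ * X)%E]fineK ?ge0_fin_numE//.
Qed.

End L2.

(** * Monotone limits in the extended reals *)

Section monotone_limits.
Local Open Scope ereal_scope.
Context (R : realType).

(** For infinite [c], multiplication is discontinuous at 0; but a nondecreasing nonnegative sequence
    with limit 0 is identically 0. *)
Lemma cvg_nondecreasing_mule (c : \bar R) (u : (\bar R)^nat) (l : \bar R) :
  (forall n, 0 <= u n) -> nondecreasing_seq u -> u n @[n --> \oo] --> l ->
  c * u n @[n --> \oo] --> c * l.
Proof.
move=> u0 nd ul; have [l0|l0] := eqVneq l 0.
  have un0 n : u n = 0.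
    apply/eqP; rewrite eq_le u0 andbT -l0.
    rewrite (cvg_unique _ ul (ereal_nondecreasing_cvgn nd))//.
    by apply: ereal_sup_ubound; exists n.
  rewrite l0 mule0 (_ : (fun _ => _) = cst 0); first exact: cvg_cst.
  by apply/funext => n; rewrite un0 mule0.
have [cf|cf] := boolP (c \is a fin_num); first exact: cvgeZl.
by apply: cvgeM => //; [exact: mule_def_infty_neq0|exact: cvg_cst].
Qed.

Context d (X : measurableType d).

Lemma cvg_integral_nondecreasing (mu : {measure set X -> \bar R})
    (u : (X -> \bar R)^nat) (f : X -> \bar R) :
  (forall n, measurable_fun setT (u n)) -> (forall n x, 0 <= u n x) ->
  (forall x, nondecreasing_seq (u ^~ x)) ->
  (forall x, u n x @[n --> \oo] --> f x) ->
  \int[mu]_x u n x @[n --> \oo] --> \int[mu]_x f x.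
Proof.
move=> mu_ u0 nd uf.
have -> : \int[mu]_x f x = \int[mu]_x (limn (u ^~ x)).
  by apply: eq_integral => x _; apply/esym/cvg_lim.
exact: cvg_monotone_convergence.
Qed.

End monotone_limits.

(** * Kernels reversible with respect to a measure *)

Section reversible_kernel.
Context d (X : measurableType d) (R : realType).
Variables (mu : {measure set X -> \bar R}) (kap : X -> {measure set X -> \bar R}).

(** The mass is bounded by 1 rather than equal to 1, because the kernels of interest are zero at
    levels that have no level set, and [H_t] is zero outside [K(t)]. *)
Definition reversible_kernel : Prop :=
  [/\ forall A, measurable A -> measurable_fun setT (fun x => kap x A),
      forall x, (kap x setT <= 1)%E &
      forall A B, measurable A -> measurable B ->
        (\int[mu]_(x in A) kap x B = \int[mu]_(x in B) kap x A)%E].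

Definition kop (f : X -> R) : X -> R := fun x => fine (\int[kap x]_y (f y)%:E)%E.

Hypothesis rev : reversible_kernel.

Let mkap A : measurable A -> measurable_fun setT (fun x => kap x A).
Proof. by case: rev => + _ _; apply. Qed.

Let kap1 x : (kap x setT <= 1)%E. Proof. by case: rev. Qed.

Let kapfin x : (kap x setT < +oo)%E.
Proof. by apply: le_lt_trans (kap1 x) _; rewrite ltry. Qed.

Lemma ge0_measurable_kernel_integral (f : X -> \bar R) :
  measurable_fun setT f -> (forall x, 0 <= f x)%E ->
  measurable_fun setT (fun x => \int[kap x]_y f y)%E.
Proof. by move=> mf f0; exact: measurable_fun_integral_kernel. Qed.

Section ereal.
Local Open Scope ereal_scope.

Let reversible_for (g f : X -> \bar R) :=
  \int[mu]_x (g x * \int[kap x]_y f y) = \int[mu]_x (f x * \int[kap x]_y g y).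

Let reversible_ext (g : X -> \bar R) :
  measurable_fun setT g -> (forall x, 0 <= g x) ->
  (forall A, measurable A -> reversible_for g (fun x => (\1_A x)%:E)) ->
  forall f, measurable_fun setT f -> (forall x, 0 <= f x) -> reversible_for g f.
Proof.
move=> mg g0 g1; have mK := ge0_measurable_kernel_integral.
have K0 h x : (forall y, 0 <= h y) -> 0 <= \int[kap x]_y h y.
  by move=> h0; exact: integral_ge0.
apply: ge0_measurable_ind; first exact: g1.
- move=> r f r0 mf f0 gf; rewrite /reversible_for.
  transitivity (r%:E * \int[mu]_x (g x * \int[kap x]_y f y)).
    rewrite -ge0_integralZl//; first last.
    + by move=> x _; rewrite mule_ge0// K0.
    + by apply: emeasurable_funM => //; exact: mK.
    by apply: eq_integral => x _; rewrite ge0_integralZl// muleCA.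
  rewrite gf -ge0_integralZl//; first last.
  + by move=> x _; rewrite mule_ge0// K0.
  + by apply: emeasurable_funM => //; exact: mK.
  by apply: eq_integral => x _; rewrite muleA.
- move=> f f' mf f0 mf' f'0 gf gf'; rewrite /reversible_for.
  transitivity (\int[mu]_x (g x * \int[kap x]_y f y) +
                \int[mu]_x (g x * \int[kap x]_y f' y)).
    rewrite -ge0_integralD//; first last.
    + by apply: emeasurable_funM => //; exact: mK.
    + by move=> x _; rewrite mule_ge0// K0.
    + by apply: emeasurable_funM => //; exact: mK.
    + by move=> x _; rewrite mule_ge0// K0.
    by apply: eq_integral => x _; rewrite ge0_integralD// ge0_muleDr// K0.
  rewrite gf gf' -ge0_integralD//; first last.
  + by apply: emeasurable_funM => //; exact: mK.
  + by move=> x _; rewrite mule_ge0// K0.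
  + by apply: emeasurable_funM => //; exact: mK.
  + by move=> x _; rewrite mule_ge0// K0.
  by apply: eq_integral => x _; rewrite ge0_muleDl.
- move=> u f mu_ u0 ndu uf gu; rewrite /reversible_for.
  have c1 : \int[mu]_x (g x * \int[kap x]_y u n y) @[n --> \oo] -->
            \int[mu]_x (g x * \int[kap x]_y f y).
    apply: cvg_integral_nondecreasing => [n|n x|x m n mn|x].
    + by apply: emeasurable_funM => //; exact: mK.
    + by rewrite mule_ge0// K0.
    + rewrite lee_wpmul2l//; apply: ge0_le_integral_lower => // y _; exact: ndu.
    + apply: cvg_nondecreasing_mule => [n|m n mn|]; first exact: K0.
      * by apply: ge0_le_integral_lower => // y _; exact: ndu.
      * exact: cvg_integral_nondecreasing.
  have c2 : \int[mu]_x (u n x * \int[kap x]_y g y) @[n --> \oo] -->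
            \int[mu]_x (f x * \int[kap x]_y g y).
    apply: cvg_integral_nondecreasing => [n|n x|x m n mn|x].
    + by apply: emeasurable_funM => //; exact: mK.
    + by rewrite mule_ge0// K0.
    + by rewrite lee_wpmul2r ?K0//; exact: ndu.
    + under eq_fun do rewrite muleC; rewrite muleC.
      exact: cvg_nondecreasing_mule.
  have uE : (fun n => \int[mu]_x (g x * \int[kap x]_y u n y)) =
            (fun n => \int[mu]_x (u n x * \int[kap x]_y g y)).
    by apply/funext => n; exact: gu.
  rewrite uE in c1.
  exact: (cvg_unique (@ereal_hausdorff R) c1 c2).
Qed.

Lemma reversible_integral (g f : X -> \bar R) :
  measurable_fun setT g -> (forall x, 0 <= g x) ->
  measurable_fun setT f -> (forall x, 0 <= f x) ->
  \int[mu]_x (g x * \int[kap x]_y f y) = \int[mu]_x (f x * \int[kap x]_y g y).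
Proof.
move=> mg g0 mf f0; have mI A : measurable A ->
    measurable_fun setT (fun x : X => (\1_A x : R)%:E).
  by move=> mA; apply/measurable_EFinP; exact: measurable_indic.
have I0 A (x : X) : 0 <= (\1_A x : R)%:E by [].
apply: reversible_ext => // A mA.
(* The identity is symmetric in its two functions, so the same extension now runs in [g] with the
   indicator of [A] fixed. *)
apply/esym/(reversible_ext (mI _ mA)) => // B mB.
rewrite /reversible_for.
have E C D : measurable C -> measurable D ->
    \int[mu]_x ((\1_C x : R)%:E * \int[kap x]_y (\1_D y)%:E) =
    \int[mu]_(x in C) kap x D.
  move=> mC mD; rewrite [RHS]integral_mkcond; apply: eq_integral => x _.
  rewrite integral_indic// setIT patchE indicE.
  by case: ifP => xC; rewrite ?mul1e ?mul0e.
rewrite !E//; by case: rev => _ _; apply.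
Qed.

End ereal.

Implicit Types f g h : X -> R.

Lemma measurable_kop f : measurable_fun setT f -> measurable_fun setT (kop f).
Proof.
move=> mf; apply: measurableT_comp => //.
have -> : (fun x => \int[kap x]_y (f y)%:E)%E = (fun x =>
    \int[kap x]_y (EFin \o f)^\+ y - \int[kap x]_y (EFin \o f)^\- y)%E.
  by apply/funext => x; rewrite integralE.
have mfE : measurable_fun setT (EFin \o f) by exact/measurable_EFinP.
by apply: emeasurable_funB; apply: ge0_measurable_kernel_integral => //;
  [exact: measurable_funepos|exact: measurable_funeneg].
Qed.

(** Jensen's inequality for the square, with a measure of mass at most 1. *)
Lemma kop_sqr_le f x : measurable_fun setT f ->
  ((kop f x ^+ 2)%:E <= \int[kap x]_y (f y ^+ 2)%:E)%E.
Proof.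
move=> mf; apply: le_trans (sqr_integral_le (kapfin x) mf) _.
rewrite -[leRHS]mul1e lee_wpmul2r//.
by apply: integral_ge0 => y _; rewrite lee_fin sqr_ge0.
Qed.

(** Reversibility against the constant 1 moves the kernel from [f ^+ 2] onto 1, where it yields its
    mass. *)
Lemma integral_kernel_sqr_le f : measurable_fun setT f ->
  (\int[mu]_x \int[kap x]_y (f y ^+ 2)%:E <= \int[mu]_x (f x ^+ 2)%:E)%E.
Proof.
move=> mf; have f20 x : (0 <= (f x ^+ 2)%:E)%E by rewrite lee_fin sqr_ge0.
have := @reversible_integral (cst 1%E) (fun x => (f x ^+ 2)%:E)
  (@measurable_cst _ _ _ _ _ _) (fun=> lee01) (measurable_EFin_sqr mf) f20.
under eq_integral do rewrite mul1e; move=> ->.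
apply: ge0_le_integral_lower => x _.
  by rewrite mule_ge0//; apply: integral_ge0.
rewrite -[leRHS]mule1 lee_wpmul2l//.
by rewrite integral_cst// mul1e.
Qed.

Lemma kop_contraction f : measurable_fun setT f ->
  (\int[mu]_x (kop f x ^+ 2)%:E <= \int[mu]_x (f x ^+ 2)%:E)%E.
Proof.
move=> mf; apply: le_trans (integral_kernel_sqr_le mf).
apply: ge0_le_integral_lower => x _; first by rewrite lee_fin sqr_ge0.
exact: kop_sqr_le.
Qed.

Lemma L2_kop f : L2 mu f -> L2 mu (kop f).
Proof.
move=> [mf f2]; split; first exact: measurable_kop.
exact: le_lt_trans (kop_contraction mf) f2.
Qed.

Lemma L2_kernel_ae f : L2 mu f -> {ae mu, forall x, L2 (kap x) f}.
Proof.
move=> [mf f2].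
have f20 y : (0 <= (f y ^+ 2)%:E)%E by rewrite lee_fin sqr_ge0.
have : mu.-integrable setT (fun x => \int[kap x]_y (f y ^+ 2)%:E)%E.
  apply/integrableP; split.
    by apply: ge0_measurable_kernel_integral => //; exact: measurable_EFin_sqr.
  under eq_integral do rewrite gee0_abs ?integral_ge0//.
  exact: le_lt_trans (integral_kernel_sqr_le mf) f2.
move=> /(integrable_ae measurableT); apply: filterS => x /= /(_ Logic.I) fx.
by split=> //; rewrite -ge0_fin_numE// integral_ge0.
Qed.

(** Additivity can fail where [fine] has replaced an infinite integral by 0. Both functions are
    square integrable for [kap x] at almost every [x], because the iterated integrals of their
    squares are finite. *)
Lemma kop_lincomb_ae a f g : L2 mu f -> L2 mu g ->
  {ae mu, forall x, kop (lincomb a f g) x = lincomb a (kop f) (kop g) x}.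
Proof.
move=> Lf Lg; have := L2_kernel_ae Lf; have := L2_kernel_ae Lg.
apply: filterS2 => x Lgx Lfx.
have fi := L2_integrable (kapfin x) Lfx; have gi := L2_integrable (kapfin x) Lgx.
rewrite /kop /lincomb.
rewrite [X in fine X](_ : _ = \int[kap x]_y (a%:E * (f y)%:E + (g y)%:E))%E//.
rewrite integralD//; last exact: integrableZl.
rewrite integralZl// fineD ?fineM//; last exact: integrable_fin_num.
all: rewrite ?fin_numM//; exact: integrable_fin_num.
Qed.

Lemma ip_kop_lincombl a f g h : L2 mu f -> L2 mu g -> L2 mu h ->
  ip mu (kop (lincomb a f g)) h = a * ip mu (kop f) h + ip mu (kop g) h.
Proof.
move=> Lf Lg Lh; rewrite -ip_lincombl//; try exact: L2_kop.
apply: ip_ae_eql => //; last exact: kop_lincomb_ae.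
- by apply/L2_kop/L2_lincomb.
- by apply: L2_lincomb; exact: L2_kop.
Qed.

Let ip_kopC_ge0 f g : L2 mu f -> L2 mu g -> (forall x, 0 <= f x) ->
  (forall x, 0 <= g x) -> ip mu (kop f) g = ip mu (kop g) f.
Proof.
move=> Lf Lg f0 g0.
have E h k : L2 mu h -> L2 mu k -> (forall x, 0 <= h x) -> (forall x, 0 <= k x) ->
    (ip mu (kop h) k)%:E = (\int[mu]_x ((k x)%:E * \int[kap x]_y (h y)%:E))%E.
  move=> Lh Lk h0 k0; rewrite ipE//; last exact: L2_kop.
  have [[mh _] [mk _]] := (Lh, Lk).
  apply: ae_eq_integral => //.
  - by apply/measurable_EFinP; apply: measurable_funM => //; exact: measurable_kop.
  - apply: emeasurable_funM; first exact/measurable_EFinP.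
    by apply: ge0_measurable_kernel_integral => //; exact/measurable_EFinP.
  - apply: filterS (L2_kernel_ae Lh) => x Lhx _.
    rewrite mulrC EFinM; congr (_ * _)%E; rewrite fineK//.
    by have := integrable_fin_num measurableT (L2_integrable (kapfin x) Lhx).
have [[mf _] [mg _]] := (Lf, Lg).
apply: EFin_inj; rewrite !E//; apply: reversible_integral => //;
  exact/measurable_EFinP.
Qed.

(** Reversibility was extended to nonnegative functions only, so both arguments are split into
    positive and negative parts. *)
Lemma ip_kopC f g : L2 mu f -> L2 mu g -> ip mu (kop f) g = ip mu (kop g) f.
Proof.
move=> Lf Lg.
have dec h : L2 mu h -> exists p n, [/\ L2 mu p, L2 mu n, (forall x, 0 <= p x),
    (forall x, 0 <= n x) & h = lincomb (-1) n p].
  move=> Lh; have [mh _] := Lh.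
  exists (h^\+), (h^\-); split.
  - apply: (L2_le _ _ Lh); first exact: measurable_funrpos.
    move=> x; rewrite /funrpos; case: (leP (h x) 0) => hx; rewrite ?expr0n ?sqr_ge0//.
  - apply: (L2_le _ _ Lh); first exact: measurable_funrneg.
    move=> x; rewrite /funrneg; case: (leP (- h x) 0) => hx; rewrite ?expr0n ?sqr_ge0 ?sqrrN//.
  - by move=> x; exact: funrpos_ge0.
  - by move=> x; exact: funrneg_ge0.
  - by apply/funext => x; rewrite /lincomb mulN1r addrC -[in LHS](funrposBneg h).
have [fp [fn [Lfp Lfn fp0 fn0 ->]]] := dec _ Lf.
have [gp [gn [Lgp Lgn gp0 gn0 ->]]] := dec _ Lg.
rewrite !ip_kop_lincombl//; try exact: L2_lincomb.
rewrite !ip_lincombr//; try exact: L2_kop.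
rewrite (ip_kopC_ge0 Lfn Lgn)// (ip_kopC_ge0 Lfn Lgp)//.
by rewrite (ip_kopC_ge0 Lfp Lgn)// (ip_kopC_ge0 Lfp Lgp)//; ring.
Qed.

End reversible_kernel.

(** * Product measure on a region, its fibres, and kernels acting along them *)

Section restricted_product.
Context d1 d2 (T1 : measurableType d1) (T2 : measurableType d2) (R : realType).
Variables (m1 : {sigma_finite_measure set T1 -> \bar R})
          (m2 : {sigma_finite_measure set T2 -> \bar R}).
Variables (E : set (T1 * T2)) (mE : measurable E).

(** Restricting the measure, rather than the domain of integration, keeps all functions on the whole
    space, where the L2 and kernel lemmas are stated. *)
Definition prod_restr : {measure set (T1 * T2) -> \bar R} := mrestr (m1 \x m2)%E mE.
Definition xsec_restr (t : T1) : {measure set T2 -> \bar R} :=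
  mrestr m2 (measurable_xsection t mE).
Definition ysec_restr (x : T2) : {measure set T1 -> \bar R} :=
  mrestr m1 (measurable_ysection x mE).

Local Open Scope ereal_scope.
Implicit Type G : T1 * T2 -> \bar R.

Let measurable_patch G : measurable_fun setT G -> measurable_fun setT (G \_ E).
Proof.
by move=> mG; apply/(measurable_restrictT G mE); exact: measurable_funTS.
Qed.

Let patch_ge0 G : (forall p, 0 <= G p) -> forall p, 0 <= (G \_ E) p.
Proof. by move=> G0 p; rewrite patchE; case: ifP. Qed.

Lemma integral_xsec_restrE t G :
  \int[xsec_restr t]_x G (t, x) = \int[m2]_x (G \_ E) (t, x).
Proof.
rewrite integral_mrestr integral_mkcond; apply: eq_integral => x _.
by rewrite !patchE mem_xsection.
Qed.

Lemma integral_ysec_restrE x G :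
  \int[ysec_restr x]_t G (t, x) = \int[m1]_t (G \_ E) (t, x).
Proof.
rewrite integral_mrestr integral_mkcond; apply: eq_integral => t _.
by rewrite !patchE mem_ysection.
Qed.

Lemma integral_prod_restrE G :
  \int[prod_restr]_p G p = \int[m1 \x m2]_p (G \_ E) p.
Proof. by rewrite integral_mrestr integral_mkcond. Qed.

Lemma measurable_integral_xsec_restr G :
  measurable_fun setT G -> (forall p, 0 <= G p) ->
  measurable_fun setT (fun t => \int[xsec_restr t]_x G (t, x)).
Proof.
move=> mG G0; under eq_fun do rewrite integral_xsec_restrE.
by apply: measurable_fun_fubini_tonelli_F; [exact: measurable_patch|exact: patch_ge0].
Qed.

Lemma measurable_integral_ysec_restr G :
  measurable_fun setT G -> (forall p, 0 <= G p) ->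
  measurable_fun setT (fun x => \int[ysec_restr x]_t G (t, x)).
Proof.
move=> mG G0; under eq_fun do rewrite integral_ysec_restrE.
by apply: measurable_fun_fubini_tonelli_G; [exact: measurable_patch|exact: patch_ge0].
Qed.

Lemma tonelli_xsec G : measurable_fun setT G -> (forall p, 0 <= G p) ->
  \int[prod_restr]_p G p = \int[m1]_t \int[xsec_restr t]_x G (t, x).
Proof.
move=> mG G0; rewrite integral_prod_restrE fubini_tonelli1//.
- by apply: eq_integral => t _; rewrite integral_xsec_restrE.
- exact: measurable_patch.
- exact: patch_ge0.
Qed.

Lemma tonelli_ysec G : measurable_fun setT G -> (forall p, 0 <= G p) ->
  \int[prod_restr]_p G p = \int[m2]_x \int[ysec_restr x]_t G (t, x).
Proof.
move=> mG G0; rewrite integral_prod_restrE fubini_tonelli2//.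
- by apply: eq_integral => t _; rewrite integral_ysec_restrE.
- exact: measurable_patch.
- exact: patch_ge0.
Qed.

Lemma integrable_mrestr d (X : measurableType d) (mu : {measure set X -> \bar R})
    (D : set X) (mD : measurable D) (f : X -> \bar R) :
  measurable_fun setT f ->
  (mrestr mu mD).-integrable setT f <-> mu.-integrable setT (f \_ D).
Proof.
move=> mf; rewrite -integrable_mkcond//.
have mfD := measurable_funTS mf.
split=> /integrableP[_ fi]; apply/integrableP; split=> //.
  by rewrite integral_mrestr in fi.
by rewrite integral_mrestr.
Qed.

Lemma fubini_xsec G : prod_restr.-integrable setT G ->
  \int[prod_restr]_p G p = \int[m1]_t \int[xsec_restr t]_x G (t, x).
Proof.
move=> iG; have mG := measurable_int _ iG.
rewrite integral_prod_restrE -integral12_prod_meas1//.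
  by apply: eq_integral => t _; rewrite integral_xsec_restrE.
exact: (proj1 (integrable_mrestr _ mE mG) iG).
Qed.

Lemma fubini_ysec G : prod_restr.-integrable setT G ->
  \int[prod_restr]_p G p = \int[m2]_x \int[ysec_restr x]_t G (t, x).
Proof.
move=> iG; have mG := measurable_int _ iG.
rewrite integral_prod_restrE -integral21_prod_meas1//.
  by apply: eq_integral => t _; rewrite integral_ysec_restrE.
exact: (proj1 (integrable_mrestr _ mE mG) iG).
Qed.

Lemma measurable_fubini_ysec G : prod_restr.-integrable setT G ->
  measurable_fun setT (fun x => \int[ysec_restr x]_t G (t, x)).
Proof.
move=> iG; have mG := measurable_int _ iG.
under eq_fun do rewrite integral_ysec_restrE.
exact: (measurable_fubini_G (proj1 (integrable_mrestr _ mE mG) iG)).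
Qed.

Lemma measurable_fubini_xsec G : prod_restr.-integrable setT G ->
  measurable_fun setT (fun t => \int[xsec_restr t]_x G (t, x)).
Proof.
move=> iG; have mG := measurable_int _ iG.
under eq_fun do rewrite integral_xsec_restrE.
exact: (measurable_fubini_F (proj1 (integrable_mrestr _ mE mG) iG)).
Qed.

Lemma ae_integrable_ysec G : prod_restr.-integrable setT G ->
  {ae m2, forall x, (ysec_restr x).-integrable setT (fun t => G (t, x))}.
Proof.
move=> iG; have mG := measurable_int _ iG.
have := ae_integrable2 (proj1 (integrable_mrestr _ mE mG) iG).
apply: filterS => x ix; apply/integrable_mrestr; first exact: measurable_fun_pair1.
apply: eq_integrable ix => // t _ /=.
by rewrite !patchE mem_ysection.
Qed.

Section kernel_family.
Variable Q : T1 * T2 -> {measure set T2 -> \bar R}.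

Definition kernel_family : Prop :=
  [/\ forall A, measurable A -> measurable_fun setT (fun p => Q p A),
      forall p, Q p setT <= 1 &
      forall t A B, measurable A -> measurable B ->
        \int[xsec_restr t]_(x in A) Q (t, x) B =
        \int[xsec_restr t]_(x in B) Q (t, x) A].

(** The image of [Q p] under [y |-> (p.1, y)]: the second coordinate moves by [Q] and the first is
    kept. The long constant is the measure structure of a pushforward. *)
Definition fibre_kernel (p : T1 * T2) : {measure set (T1 * T2) -> \bar R} :=
  measure_function_pushforward__canonical__measure_function_Measure
    (Q p) (pair1_measurable p.1).

Hypothesis famQ : kernel_family.

Lemma fam_reversible t : reversible_kernel (xsec_restr t) (fun x => Q (t, x)).
Proof.
case: famQ => mQ Q1 revQ; split=> // [A mA|A B]; last exact: revQ.
exact: (measurable_fun_pair2 t (mQ A mA)).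
Qed.

Let mQ : forall U, measurable U -> measurable_fun [set: T1 * T2] (Q ^~ U).
Proof. by case: famQ. Qed.

Let Quub : measure_fam_uub Q.
Proof.
(* The uniform bound has to be strict, hence 2 and not 1. *)
exists 2%R => p; case: famQ => _ Q1 _.
by apply: le_lt_trans (Q1 p) _; rewrite lte_fin ltr1n.
Qed.

Let Qker := isKernel.Build _ _ _ _ _ Q mQ.
Let Qk : R.-ker (T1 * T2) ~> T2 := HB.pack Q Qker.
Let Qfin := Kernel_isFinite.Build _ _ _ _ _ Qk Quub.
Let Qf : R.-fker (T1 * T2) ~> T2 := HB.pack Q Qker Qfin.

Lemma fibre_kernelE p A : fibre_kernel p A = Q p (xsection A p.1).
Proof. by rewrite /fibre_kernel /= /pushforward xsectionE. Qed.

Lemma measurable_fibre_kernel A : measurable A ->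
  measurable_fun setT (fun p => fibre_kernel p A).
Proof.
(* [fibre_kernel p A] is the [Q p]-mass of the section of [A] at [p.1], which is also the section of
   [A'] at the full point [p]; in this form the measurability of kernels on sections applies. *)
move=> mA; pose A' : set ((T1 * T2) * T2) := [set z | A (z.1.1, z.2)].
have mA' : measurable A'.
  rewrite -[A']setTI.
  apply: (@measurable_fun_pair _ _ _ _ _ _ (fst \o fst) snd) => //.
  by apply: measurableT_comp; exact: measurable_fst.
have := measurable_fun_xsection_finite_kernel Qf (mem_set mA').
congr measurable_fun; apply/funext => p; rewrite fibre_kernelE; congr (Q p _).
Qed.

Lemma fibre_reversible : reversible_kernel prod_restr fibre_kernel.
Proof.
split; first exact: measurable_fibre_kernel.
  by move=> p; case: famQ => _ + _; apply.
move=> A B mA mB.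
have step C D : measurable C -> measurable D ->
  \int[prod_restr]_(p in C) fibre_kernel p D =
  \int[m1]_t \int[xsec_restr t]_(x in xsection C t) Q (t, x) (xsection D t).
  move=> mC mD; rewrite integral_mkcond tonelli_xsec.
  - apply: eq_integral => t _; rewrite [RHS]integral_mkcond.
    by apply: eq_integral => x _; rewrite !patchE mem_xsection fibre_kernelE.
  - apply/(measurable_restrictT _ mC)/measurable_funTS.
    exact: measurable_fibre_kernel.
  - by move=> p; rewrite patchE; case: ifP.
rewrite (step _ _ mA mB) (step _ _ mB mA); apply: eq_integral => t _.
by case: famQ => _ _; apply; exact: measurable_xsection.
Qed.

Definition fibre_op (F : T1 * T2 -> R) : T1 * T2 -> R :=
  fun p => kop (fun x => Q (p.1, x)) (fun y => F (p.1, y)) p.2.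

Lemma kop_fibre F : measurable_fun setT F -> kop fibre_kernel F = fibre_op F.
Proof.
move=> mF; apply/funext => -[t x]; rewrite /kop /fibre_op /=; congr fine.
have mFE : measurable_fun setT (EFin \o F) by exact/measurable_EFinP.
rewrite [LHS]integralE [RHS]integralE; congr (_ - _).
- rewrite ge0_integral_pushforward//; last exact: measurable_funepos.
  by apply: eq_integral => y _ /=; rewrite !funeposE.
- rewrite ge0_integral_pushforward//; last exact: measurable_funeneg.
  by apply: eq_integral => y _ /=; rewrite !funenegE.
Qed.

End kernel_family.
End restricted_product.

(** * Symmetric operators: moments, projections, centered forms *)

Section symmetric_operators.
Context d (X : measurableType d) (R : realType).
Variable mu : {measure set X -> \bar R}.
Hypothesis mufin : (mu setT < +oo)%E.
Local Notation L2 := (L2 mu).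
Local Notation ip := (ip mu).
Implicit Types f g h : X -> R.

(** Linearity is required under [ip] only, because kernel operators are linear just almost
    everywhere. *)
Definition sym_op (P : (X -> R) -> X -> R) : Prop :=
  [/\ forall f, L2 f -> L2 (P f),
      forall a f g h, L2 f -> L2 g -> L2 h ->
        ip (P (lincomb a f g)) h = a * ip (P f) h + ip (P g) h &
      forall f g, L2 f -> L2 g -> ip (P f) g = ip (P g) f].

Lemma sym_op_kop (kap : X -> {measure set X -> \bar R}) :
  reversible_kernel mu kap -> sym_op (kop kap).
Proof.
move=> rev; split=> *; [exact: L2_kop|exact: ip_kop_lincombl|exact: ip_kopC].
Qed.

Definition psd_op (P : (X -> R) -> X -> R) : Prop :=
  forall f, L2 f -> 0 <= ip (P f) f.

Section moments.
Variable P : (X -> R) -> X -> R.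
Hypotheses (symP : sym_op P) (psdP : psd_op P).

Lemma L2_iter j f : L2 f -> L2 (iter j P f).
Proof. by move=> Lf; elim: j => //= j; case: symP => + _ _; apply. Qed.

Lemma ip_iter i j f g : L2 f -> L2 g ->
  ip (iter (i + j) P f) g = ip (iter i P f) (iter j P g).
Proof.
case: symP => _ _ PC Lf Lg; elim: j i => [|j IH] i; first by rewrite addn0.
rewrite addnS -addSn IH iterS PC//; [|exact: L2_iter..].
by rewrite ipC.
Qed.

(* The second difference of the moments [ip (P^j f) f] is [|h|^2] or
   [ip (P h) h], where [h = P^(i+1) f - P^i f], according to the parity of j. *)
Lemma moment_convex j f : L2 f -> 2 * ip (iter j.+1 P f) f <=
  ip (iter j.+2 P f) f + ip (iter j P f) f.
Proof.
move=> Lf; case: (symP) => LP Plin PC.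
have LI i : L2 (iter i P f) by exact: L2_iter.
have jE := odd_double_half j; rewrite -addnn in jE.
set i := j./2 in jE.
have Lh : L2 (lincomb (-1) (iter i P f) (iter i.+1 P f)) by exact: L2_lincomb.
have mom a b : ip (iter a P f) (iter b P f) = ip (iter (a + b) P f) f.
  by rewrite ip_iter.
case: (odd j) jE => jE.
- have := psdP Lh; rewrite ip_lincombr//; last exact: LP.
  rewrite !Plin// -!iterS !mom.
  rewrite (_ : (i.+1 + i = j)%N); last by rewrite -jE addSn.
  rewrite (_ : (i.+2 + i = j.+1)%N); last by rewrite -jE addSn.
  rewrite (_ : (i.+1 + i.+1 = j.+1)%N); last by rewrite -jE addnS.
  rewrite (_ : (i.+2 + i.+1 = j.+2)%N); last by rewrite -jE addnS.
  by move=> *; lra.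
- have := ip_ge0 mu (lincomb (-1) (iter i P f) (iter i.+1 P f)).
  rewrite ip_lincombr// !ip_lincombl// !mom.
  rewrite (_ : (i + i = j)%N); last by rewrite -jE.
  rewrite (_ : (i.+1 + i = j.+1)%N); last by rewrite -jE.
  rewrite (_ : (i + i.+1 = j.+1)%N); last by rewrite -jE addnS.
  rewrite (_ : (i.+1 + i.+1 = j.+2)%N); last by rewrite -jE addnS.
  by move=> *; lra.
Qed.

Lemma moment_ge k f : L2 f ->
  k%:R * (ip (P f) f - ip f f) <= ip (iter k P f) f - ip f f.
Proof.
move=> Lf; pose a j := ip (iter j P f) f.
have inc j : a 1%N - a 0%N <= a j.+1 - a j.
  elim: j => // j IH; apply: (le_trans IH).
  by have := moment_convex j Lf; rewrite -/(a _) -/(a _) -/(a _); lra.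
rewrite -/(a 1%N) -/(a 0%N) -/(a k).
elim: k => [|k IH]; first by rewrite mul0r subrr.
by have := inc k; rewrite -natr1 mulrDl mul1r; lra.
Qed.

End moments.

Section fixed_projection.
Variables P U : (X -> R) -> X -> R.
Hypotheses (symP : sym_op P) (psdP : psd_op P) (symU : sym_op U).
Hypothesis UU : forall f g, L2 f -> L2 g -> ip (U (U f)) g = ip (U f) g.
Hypothesis PU : forall f g, L2 f -> L2 g -> ip (P (U f)) g = ip (U f) g.

Lemma ip_projection f : L2 f -> ip (U f) f = ip (U f) (U f).
Proof.
case: symU => LU _ UC Lf; rewrite -[LHS]UU//.
by rewrite UC//; exact: LU.
Qed.

(** Positivity of [P] at [f - U f]: as [P] fixes [U f] and is symmetric, the cross terms reduce to
    [ip (U f) f] and the value is [ip (P f) f - ip (U f) f]. *)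
Lemma projection_le f : L2 f -> ip (U f) f <= ip (P f) f.
Proof.
move=> Lf; case: (symU) (symP) => LU _ _ [LP Plin PC].
have LUf := LU _ Lf; have Lh := L2_lincomb (-1) LUf Lf.
have := psdP Lh; rewrite Plin// !ip_lincombr//; try exact: LP.
rewrite (PC f (U f))// !PU// -ip_projection//.
by lra.
Qed.

End fixed_projection.

(** A projection satisfies [ip (U f) f = ip (U f) (U f)], and Cauchy-Schwarz against 1 applies to
    [U f], which has the same integral as [f]. This is the positivity of the centered form of
    [U]. *)
Lemma projection_ge_mean (U : (X -> R) -> X -> R) f :
  sym_op U -> (forall f g, L2 f -> L2 g -> ip (U (U f)) g = ip (U f) g) ->
  ip (U f) (cst 1) = ip f (cst 1) -> L2 f ->
  ip f (cst 1) ^+ 2 <= ip (U f) f * ip (cst 1) (cst 1).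
Proof.
move=> symU UU U1 Lf; rewrite ip_projection// -U1.
apply: (semi_inner_cauchy_schwarz (semi_inner_ip _)) => //.
- by case: symU => + _ _; apply.
- exact: L2_cst.
Qed.

Definition centered_form (P : (X -> R) -> X -> R) f g : R :=
  ip (P f) g - ip f (cst 1) * ip g (cst 1) / ip (cst 1) (cst 1).

Lemma semi_inner_centered P : sym_op P ->
  (forall f, L2 f -> 0 <= centered_form P f f) -> semi_inner L2 (centered_form P).
Proof.
move=> [LP Plin PC] q0; split=> // [a f g Lf Lg|f g Lf Lg|a f g h Lf Lg Lh].
- exact: L2_lincomb.
- by rewrite /centered_form PC// [X in _ - X / _]mulrC.
- rewrite /centered_form Plin// ip_lincombl//; last exact: L2_cst.
  by ring.
Qed.

End symmetric_operators.

(** * Averaging over the fibre above a base point *)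

Section fibre_average.
Context d1 d2 (T1 : measurableType d1) (T2 : measurableType d2) (R : realType).
Variables (m1 : {sigma_finite_measure set T1 -> \bar R})
          (m2 : {sigma_finite_measure set T2 -> \bar R}).
Variables (E : set (T1 * T2)) (mE : measurable E).
Local Notation M := (prod_restr m1 m2 mE).
Local Notation ysec := (ysec_restr m1 mE).
Hypothesis Mfin : (M setT < +oo)%E.
Hypothesis ysecfin : forall x, (ysec x setT < +oo)%E.
Implicit Types (G : T1 * T2 -> R) (f g : T2 -> R).

Definition fibre_avg G (x : T2) : R :=
  fine (\int[ysec x]_t (G (t, x))%:E)%E / fine (ysec x setT).

Lemma measurable_ysec_mass : measurable_fun setT (fun x => ysec x setT).
Proof.
rewrite (_ : (fun x => _) = (fun x => \int[ysec x]_t (cst 1%E) (t, x))%E).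
  by apply: measurable_integral_ysec_restr => //; exact: measurable_cst.
by apply/funext => x; rewrite integral_cst// mul1e.
Qed.

Lemma measurable_fibre_avg G : measurable_fun setT G ->
  measurable_fun setT (fibre_avg G).
Proof.
move=> mG; apply: measurable_funM.
  apply: measurableT_comp => //.
  have -> : (fun x => \int[ysec x]_t (G (t, x))%:E)%E = (fun x =>
      \int[ysec x]_t (EFin \o G)^\+ (t, x) - \int[ysec x]_t (EFin \o G)^\- (t, x))%E.
    apply/funext => x; rewrite integralE; congr (_ - _)%E;
      by apply: eq_integral => t _; rewrite ?funeposE ?funenegE.
  have mGE : measurable_fun setT (EFin \o G) by exact/measurable_EFinP.
  by apply: emeasurable_funB; apply: measurable_integral_ysec_restr => //;
    [exact: measurable_funepos|exact: measurable_funeneg].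
rewrite (_ : (fun x => _) = (fun x => fine (ysec x setT) `^ (-1))); last first.
  by apply/funext => x; rewrite powR_inv1// fine_ge0.
apply: (measurableT_comp (measurable_powR _)).
by apply: (measurableT_comp (fine_measurable measurableT)); exact: measurable_ysec_mass.
Qed.

Lemma integral_base (f : T2 -> \bar R) : measurable_fun setT f ->
  (forall x, 0 <= f x)%E ->
  (\int[M]_p f p.2 = \int[m2]_x (f x * ysec x setT))%E.
Proof.
move=> mf f0; rewrite tonelli_ysec//.
  by apply: eq_integral => x _; exact: (integral_cst _ measurableT (f x)).
by apply: measurableT_comp => //; exact: measurable_snd.
Qed.

Let ysec_fin_num x : ysec x setT \is a fin_num.
Proof. by rewrite ge0_fin_numE. Qed.

Lemma fibre_avg_sqr_le G x : measurable_fun setT G ->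
  ((fibre_avg G x ^+ 2)%:E * ysec x setT <= \int[ysec x]_t (G (t, x) ^+ 2)%:E)%E.
Proof.
move=> mG; have mGx := measurable_fun_pair1 x mG.
have := sqr_integral_le (ysecfin x) mGx.
have I0 : (0 <= \int[ysec x]_t (G (t, x) ^+ 2)%:E)%E.
  by apply: integral_ge0 => t _; rewrite lee_fin sqr_ge0.
rewrite /fibre_avg; set a := fine (\int[_]_t (G (t, x))%:E)%E.
rewrite -(fineK (ysec_fin_num x)) [fine (fine _)%:E]/=.
have : 0 <= fine (ysec x setT) by exact: fine_ge0.
set c := fine _ => c0; have [->|cn0] := eqVneq c 0.
  by rewrite mule0 => _.
have cp : 0 < c by rewrite lt_neqAle eq_sym cn0.
move=> le; rewrite -EFinM (_ : _ * c = c^-1 * a ^+ 2); last by field.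
rewrite EFinM muleC lee_pdivrMr//.
by rewrite muleC.
Qed.

Lemma L2_fibre_avg G : L2 M G -> L2 M (fibre_avg G \o snd).
Proof.
move=> [mG G2]; have mA := measurable_fibre_avg mG; split.
  by apply: measurableT_comp => //; exact: measurable_snd.
apply: le_lt_trans G2.
rewrite (integral_base (measurable_EFin_sqr mA)); last first.
  by move=> x; rewrite lee_fin sqr_ge0.
rewrite (tonelli_ysec m1 m2 mE (measurable_EFin_sqr mG)); last first.
  by move=> p; rewrite lee_fin sqr_ge0.
apply: ge0_le_integral_lower => x _; last exact: fibre_avg_sqr_le.
by rewrite mule_ge0// lee_fin sqr_ge0.
Qed.

(** At fixed [x] the factor [g x] leaves the integral over the fibre, and the average times the mass
    of the fibre is the integral of [G] over it. *)
Lemma ip_fibre_avg G g : L2 M G -> L2 M (g \o snd) ->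
  ip M (fibre_avg G \o snd) (g \o snd) = ip M G (g \o snd).
Proof.
move=> LG Lg; have LA := L2_fibre_avg LG.
have i1 := L2_integrable_mul LA Lg; have i2 := L2_integrable_mul LG Lg.
apply: EFin_inj; rewrite !ipE//.
rewrite (fubini_ysec i1) (fubini_ysec i2).
apply: ae_eq_integral => //.
- exact: (measurable_fubini_ysec i1).
- exact: (measurable_fubini_ysec i2).
- have := ae_integrable_ysec (L2_integrable Mfin LG).
  apply: filterS => x ix _ /=.
  under [RHS]eq_integral do rewrite mulrC EFinM.
  rewrite integralZl//= integral_cst//= /fibre_avg.
  have := integrable_fin_num measurableT ix; rewrite /= => Ifin.
  (* On a null fibre the average is the default value of a division by 0, but both integrals over
     the fibre vanish. *)
  have [c0|c0] := eqVneq (ysec x setT) 0%E.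
    rewrite c0 mule0 (_ : \int[_]_t _ = 0)%E ?mule0//.
    have [mG _] := LG; have mGx := measurable_fun_pair1 x mG.
    apply: null_set_integral => //; exact/measurable_EFinP.
  rewrite -[in LHS](fineK (ysec_fin_num x)).
  rewrite -[in RHS](fineK Ifin) -!EFinM; congr EFin.
  have : fine (ysec x setT) != 0 by rewrite fine_eq0// ysec_fin_num.
  by set c := fine (ysec x setT); rewrite [fine c%:E]/= => ?; field.
Qed.

End fibre_average.

(** * Positive homogeneity at every point *)

Section homogeneity.
Context d (X : measurableType d) (R : realType).
Local Open Scope ereal_scope.

(** For the difference of the integrals of positive and negative parts, including the convention for
    [+oo - +oo], so that scaling needs no integrability. *)
Lemma ge0_muleB (c : R) (a b : \bar R) : (0 <= c)%R -> 0 <= a -> 0 <= b ->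
  c%:E * a - c%:E * b = c%:E * (a - b).
Proof.
rewrite le_eqVlt => /orP[/eqP <-|c0]; first by rewrite !mul0e subee.
have cy : c%:E * +oo = +oo by rewrite gt0_muley ?lte_fin.
have cNy : c%:E * -oo = -oo by rewrite gt0_muleNy ?lte_fin.
case: a => [a| |] a0; case: b => [b| |] b0 //.
- by rewrite -!EFinM -!EFinB mulrBr.
- by rewrite cy addeNy.
- by rewrite cy addye.
- by rewrite cy addeNy.
Qed.

Lemma integralZ_ge0 (mu : {measure set X -> \bar R}) (c : R) (f : X -> R) :
  (0 <= c)%R -> measurable_fun setT f ->
  \int[mu]_x (c * f x)%:E = c%:E * \int[mu]_x (f x)%:E.
Proof.
move=> c0 mf; have mfE : measurable_fun setT (EFin \o f) by exact/measurable_EFinP.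
under eq_integral do rewrite EFinM.
rewrite [LHS]integralE [in RHS]integralE ge0_funeposM// ge0_funenegM//.
rewrite -ge0_muleB//; try exact: integral_ge0.
rewrite !ge0_integralZl_EFin//; try exact: measurable_funepos.
exact: measurable_funeneg.
Qed.

Lemma fineZ (c : R) (a : \bar R) : (0 < c)%R -> fine (c%:E * a) = (c * fine a)%R.
Proof.
move=> c0; case: a => [r| |] //=; first by rewrite gt0_muley ?lte_fin//= mulr0.
by rewrite gt0_muleNy ?lte_fin//= mulr0.
Qed.

Lemma fine_integral_mscale (mu : {measure set X -> \bar R}) (c : {nonneg R})
    (f : X -> R) : measurable_fun setT f ->
  fine (\int[mscale c mu]_x (f x)%:E) = (c%:num * fine (\int[mu]_x (f x)%:E))%R.
Proof.
move=> mf; have mfE : measurable_fun setT (EFin \o f) by exact/measurable_EFinP.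
rewrite [X in fine X = _]integralE !ge0_integral_mscale//;
  try exact: measurable_funepos; try exact: measurable_funeneg.
rewrite ge0_muleB//; try exact: integral_ge0.
rewrite -integralE.
have [->|c0] := eqVneq c%:num 0%R; first by rewrite mul0e mul0r.
by rewrite fineZ// lt_neqAle eq_sym c0/=.
Qed.

(** Unlike additivity this holds at every point, since scaling by [c > 0] preserves the infinite
    values that [fine] sends to 0. It allows test functions to be normalised in the norms on the
    levels. *)
Lemma kopZ (kap : X -> {measure set X -> \bar R}) (c : R) (f : X -> R) :
  (0 < c)%R -> measurable_fun setT f ->
  kop kap (fun x => c * f x)%R = (fun x => c * kop kap f x)%R.
Proof.
move=> c0 mf; apply/funext => x; rewrite /kop integralZ_ge0//; last exact: ltW.
exact: fineZ.
Qed.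

End homogeneity.

Lemma measurable_funV_ge0 d (X : measurableType d) (R : realType) (f : X -> R) :
  measurable_fun setT f -> (forall x, 0 <= f x) ->
  measurable_fun setT (fun x => (f x)^-1).
Proof.
move=> mf f0; rewrite (_ : (fun x => _) = (fun x => f x `^ (-1))); last first.
  by apply/funext => x; rewrite powR_inv1.
exact: (measurableT_comp (measurable_powR _)).
Qed.

(** * Fibrewise operators, deviation from the mean, uniform kernels *)

Section fibre_operators.
Context d1 d2 (T1 : measurableType d1) (T2 : measurableType d2) (R : realType).
Variables (m1 : {sigma_finite_measure set T1 -> \bar R})
          (m2 : {sigma_finite_measure set T2 -> \bar R}).
Variables (E : set (T1 * T2)) (mE : measurable E).
Local Notation M := (prod_restr m1 m2 mE).
Local Notation ysec := (ysec_restr m1 mE).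
Local Notation xsec := (xsec_restr m2 mE).
Hypothesis Mfin : (M setT < +oo)%E.
Implicit Types (F G : T1 * T2 -> R) (f g : T2 -> R).

Lemma eq_ip_on F G h : (forall p, E p -> F p = G p) -> ip M F h = ip M G h.
Proof.
move=> FG; rewrite /ip /Rintegral !integral_mrestr; congr fine.
by apply: eq_integral => p /[!inE] /FG ->.
Qed.

Lemma measurable_fibre_op Q F : kernel_family m2 mE Q -> measurable_fun setT F ->
  measurable_fun setT (fibre_op Q F).
Proof.
move=> famQ mF; rewrite -kop_fibre//.
exact: measurable_kop (fibre_reversible m1 famQ) _ mF.
Qed.

Lemma sym_op_fibre Q : kernel_family m2 mE Q -> sym_op M (fibre_op Q).
Proof.
move=> famQ; have [LP Plin PC] := sym_op_kop (fibre_reversible m1 famQ).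
have kE F : L2 M F -> kop (fibre_kernel Q) F = fibre_op Q F.
  by case=> mF _; rewrite kop_fibre.
split=> [F LF|a F G h LF LG Lh|F G LF LG].
- by rewrite -kE//; exact: LP.
- by rewrite -!kE//; [exact: Plin|exact: L2_lincomb].
- by rewrite -!kE//; exact: PC.
Qed.

Lemma iter_fibre_op Q k F t x :
  iter k (fibre_op Q) F (t, x) =
  iter k (kop (fun x => Q (t, x))) (fun y => F (t, y)) x.
Proof.
elim: k x => //= k IH x; rewrite {1}/fibre_op /=; congr kop.
by apply/funext => y; rewrite IH.
Qed.

Section deviation.
Hypothesis ysecfin : forall x, (ysec x setT < +oo)%E.
Variable P : (T1 * T2 -> R) -> T1 * T2 -> R.
Hypothesis symP : sym_op M P.

(** The sampler built from [P], minus [S], expressed through the measure on the product. *)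
Definition deviation f (x : T2) : R :=
  fibre_avg m1 mE (P (f \o snd)) x -
  ip M (f \o snd) (cst 1) / ip M (cst 1) (cst 1).

Let deviationE f : deviation f \o @snd T1 T2 =
  lincomb (- (ip M (f \o snd) (cst 1) / ip M (cst 1) (cst 1))) (cst 1)
    (fibre_avg m1 mE (P (f \o snd)) \o snd).
Proof. by apply/funext => p; rewrite /= /lincomb mulr1 addrC. Qed.

Lemma L2_deviation f : L2 M (f \o snd) -> L2 M (deviation f \o snd).
Proof.
move=> Lf; rewrite deviationE; apply: L2_lincomb; first exact: L2_cst.
by apply: L2_fibre_avg => //; case: symP => + _ _; apply.
Qed.

Lemma ip_deviation f g : L2 M (f \o snd) -> L2 M (g \o snd) ->
  ip M (deviation f \o snd) (g \o snd) =
  centered_form M P (f \o snd) (g \o snd).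
Proof.
move=> Lf Lg; have LP : L2 M (P (f \o snd)) by case: symP => + _ _; apply.
have LA := L2_fibre_avg ysecfin LP.
rewrite deviationE ip_lincombl//; last exact: L2_cst.
rewrite ip_fibre_avg// /centered_form (ipC _ (cst 1)); ring.
Qed.

(* [a] is any function agreeing with the deviation on [E], such as its extension
   by [0]: the bound on the form is only available for functions of that kind. *)
Lemma deviation_le c f a : 0 <= c ->
  (forall F, L2 M F -> 0 <= centered_form M P F F) ->
  L2 M (f \o snd) -> L2 M (a \o snd) ->
  (forall p, E p -> deviation f p.2 = a p.2) ->
  (forall g, g = f \/ g = a -> centered_form M P (g \o snd) (g \o snd) <=
     c * ip M (g \o snd) (g \o snd)) ->
  ip M (deviation f \o snd) (deviation f \o snd) <=
    c ^+ 2 * ip M (f \o snd) (f \o snd).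
Proof.
move=> c0 q0 Lf La fa qc.
have cs := semi_inner_cauchy_schwarz (semi_inner_centered Mfin symP q0) Lf La.
have qf := qc _ (or_introl erefl); have qa := qc _ (or_intror erefl).
have f0 := ip_ge0 M (f \o snd).
have devE h : ip M (deviation f \o snd) h = ip M (a \o snd) h by exact: eq_ip_on.
rewrite -[X in X ^+ 2]ip_deviation// devE in cs.
rewrite devE ipC devE.
set N := ip M (a \o snd) (a \o snd) in cs qa *.
have N0 : 0 <= N by exact: ip_ge0.
have [->|Nn0] := eqVneq N 0; first by rewrite mulr_ge0// sqr_ge0.
have Np : 0 < N by rewrite lt_neqAle eq_sym Nn0.
have : N ^+ 2 <= (c * ip M (f \o snd) (f \o snd)) * (c * N).
  by apply: (le_trans cs); apply: ler_pM => //; exact: q0.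
by rewrite expr2 mulrA ler_pM2r// => /le_trans; apply; rewrite expr2 mulrAC.
Qed.

Lemma centered_le_deviation c f : 0 <= c -> L2 M (f \o snd) ->
  ip M (deviation f \o snd) (deviation f \o snd) <=
    c ^+ 2 * ip M (f \o snd) (f \o snd) ->
  centered_form M P (f \o snd) (f \o snd) <= c * ip M (f \o snd) (f \o snd).
Proof.
move=> c0 Lf le; have La := L2_deviation Lf.
have cs := semi_inner_cauchy_schwarz (semi_inner_ip M) La Lf.
have f0 := ip_ge0 M (f \o snd); rewrite -ip_deviation//.
set q := ip M (deviation f \o snd) (f \o snd) in cs *.
have [q0|q0] := leP q 0; first by apply: (le_trans q0); rewrite mulr_ge0.
rewrite -ler_sqr ?nnegrE ?mulr_ge0//; last exact: ltW.
by apply: (le_trans cs); rewrite exprMn expr2 mulrA ler_wpM2r.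
Qed.

End deviation.

Section uniform_family.
Hypothesis xsecfin : forall t, (xsec t setT < +oo)%E.

Let inv_mass_ge0 t : 0 <= (fine (xsec t setT))^-1.
Proof. by rewrite invr_ge0 fine_ge0. Qed.

(** At a level of mass 0 the factor is [0^-1 = 0], so the measure is zero and its total mass still
    does not exceed 1. *)
Definition unif_family (p : T1 * T2) : {measure set T2 -> \bar R} :=
  mscale (NngNum (inv_mass_ge0 p.1)) (xsec p.1).

Lemma kernel_family_unif : kernel_family m2 mE unif_family.
Proof.
have fin t A : measurable A -> xsec t A \is a fin_num.
  move=> mA; rewrite ge0_fin_numE//; apply: le_lt_trans (xsecfin t).
  by apply: le_measure; rewrite ?inE.
have mass A : measurable A -> measurable_fun setT (fun t => xsec t A).
  move=> mA; rewrite (_ : (fun t => _) =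
    (fun t => \int[xsec t]_x ((\1_A (t, x).2)%:E))%E); last first.
    by apply/funext => t; rewrite integral_indic// setIT.
  apply: (measurable_integral_xsec_restr _ _
    (G := fun p => (\1_A p.2)%:E)) => //.
  apply/measurable_EFinP; apply: measurableT_comp; last exact: measurable_snd.
  exact: measurable_indic.
split.
- move=> A mA; apply: (@measurableT_comp _ _ _ _ _ _ (fun t =>
    ((fine (xsec t setT))^-1)%:E * xsec t A)%E _ fst); last exact: measurable_fst.
  apply: emeasurable_funM; last exact: mass.
  apply/measurable_EFinP; apply: measurable_funV_ge0 => [|t]; last exact: fine_ge0.
  by apply: (measurableT_comp (fine_measurable measurableT)); exact: mass.
- move=> [t x] /=; rewrite /mscale /= -(fineK (fin t setT measurableT)) -EFinM lee_fin.
  have [->|m0] := eqVneq (fine (xsec t setT)) 0; first by rewrite mulr0.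
  by rewrite mulVf.
- move=> t A B mA mB.
  have E1 C D : measurable C -> (\int[xsec t]_(x in C) unif_family (t, x) D =
      ((fine (xsec t setT))^-1)%:E * xsec t D * xsec t C)%E.
    move=> mC; rewrite -(integral_cst _ mC).
    by apply: eq_integral.
  by rewrite !E1// -!muleA [in RHS](muleC (xsec t A)).
Qed.

Lemma fibre_op_unif F t x : measurable_fun setT F ->
  fibre_op unif_family F (t, x) =
  fine (\int[xsec t]_y (F (t, y))%:E)%E / fine (xsec t setT).
Proof.
move=> mF; rewrite mulrC.
exact: (fine_integral_mscale _ _ (measurable_fun_pair2 t mF)).
Qed.

End uniform_family.
End fibre_operators.

(** * Extension by 0 and the space under the graph of [rho] *)

Definition ext0 (U : Type) (R : realType) (D : set U) (f : U -> R) : U -> R :=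
  patch (fun=> 0) D f.

Lemma ext0T (U : Type) (R : realType) (D : set U) (f : U -> R) x :
  D x -> ext0 D f x = f x.
Proof. by move=> Dx; rewrite /ext0 patchT ?inE. Qed.

Lemma measurable_ext0 d (U : measurableType d) (R : realType) (f : U -> R) D :
  measurable D -> measurable_fun D f -> measurable_fun setT (ext0 D f).
Proof.
move=> mD mf.
rewrite (_ : ext0 D f = fine \o ((EFin \o f) \_ D)); last first.
  by apply/funext => x; rewrite /ext0 /= /patch; case: ifP.
apply: measurableT_comp => //.
by apply/(measurable_restrictT _ mD)/measurable_EFinP.
Qed.

Section slice_space.
Context (R : realType) (d : nat).
Local Notation T := (d.-tuple R).
Local Notation leb := (@lebesgue_measure R).
Variables (vol : {sigma_finite_measure set T -> \bar R}) (K : set T) (rho : T -> R).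
Hypotheses (mK : measurable K) (mrho : measurable_fun K rho)
  (rho0 : forall x, K x -> 0 <= rho x)
  (Zpos : (0 < Zrho vol K rho)%E) (Zfin : (Zrho vol K rho < +oo)%E)
  (levels : forall t, 0 < t -> (t%:E < rho_sup K rho)%E ->
     (0 < vol (Klev K rho t))%E /\ (vol (Klev K rho t) < +oo)%E).

(** These are the levels at which the assumptions on [H_t] and on the volume of [K(t)] speak. *)
Definition level_dom (t : R) : Prop := 0 < t /\ (t%:E < rho_sup K rho)%E.

(* Closed at [t = rho x], so that the section at a level [t] is exactly [K(t)]. *)
Definition slice_set : set (R * T) :=
  [set p | [/\ K p.2, p.1 <= rho p.2 & level_dom p.1]].

Lemma measurable_level_dom : measurable (level_dom : set R).
Proof.
rewrite (_ : level_dom = [set t | 0 < t] `&` [set t | (t%:E < rho_sup K rho)%E])//.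
apply: measurableI.
  by rewrite (_ : [set t | _] = [set` `]0, +oo[])//; apply/seteqP; split => t /=;
    rewrite in_itv/= andbT.
case: (rho_sup K rho) => [r| |].
- rewrite (_ : [set t | _] = [set` `]-oo, r[])//; apply/seteqP; split => t /=;
    by rewrite in_itv/= lte_fin.
- by rewrite (_ : [set t | _] = setT)//; apply/seteqP; split => t //= _; rewrite ltry.
- by rewrite (_ : [set t | _] = set0)//; apply/seteqP; split.
Qed.

Lemma measurable_under_graph : measurable [set p : R * T | K p.2 /\ p.1 <= rho p.2].
Proof.
rewrite (_ : [set p | _] = (snd @^-1` K) `&` [set p : R * T | p.1 <= ext0 K rho p.2]).
  apply: measurableI.
    by rewrite -[X in measurable X]setTI; exact: measurable_snd.
  have m : measurable_fun setT (fun p : R * T => p.1 <= ext0 K rho p.2).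
    apply: measurable_fun_ler; first exact: measurable_fst.
    by apply: measurableT_comp; [exact: measurable_ext0|exact: measurable_snd].
  by have := m measurableT [set true] Logic.I; rewrite setTI.
apply/seteqP; split => -[t x] /= [Kx tx]; split=> //.
  by rewrite ext0T.
by rewrite ext0T in tx.
Qed.

Lemma measurable_slice_set : measurable slice_set.
Proof.
rewrite (_ : slice_set = [set p : R * T | K p.2 /\ p.1 <= rho p.2] `&`
    (fst @^-1` level_dom)).
  apply: measurableI; first exact: measurable_under_graph.
  rewrite -[X in measurable X]setTI; apply: measurable_fst => //.
  exact: measurable_level_dom.
by apply/seteqP; split => -[t x] /=; [case=> *; split|case=> -[]].
Qed.
Local Notation mE := measurable_slice_set.

Definition slice_measure := prod_restr leb vol mE.
Local Notation M := slice_measure.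
Local Notation xsec := (xsec_restr vol mE).
Local Notation ysec := (ysec_restr leb mE).

Lemma rho_le_sup x : K x -> ((rho x)%:E <= rho_sup K rho)%E.
Proof. by move=> Kx; apply: ereal_sup_ubound; exists x. Qed.

Lemma xsection_slice t : level_dom t -> xsection slice_set t = Klev K rho t.
Proof.
by move=> Dt; apply/seteqP; split => x; rewrite /xsection /= inE /slice_set /=;
  [case|case=> *; split].
Qed.

Lemma xsection_slice0 t : ~ level_dom t -> xsection slice_set t = set0.
Proof.
by move=> Dt; apply/seteqP; split => x; rewrite /xsection //= inE /slice_set /= => -[].
Qed.

Lemma measurable_Klev t : level_dom t -> measurable (Klev K rho t).
Proof. by move=> Dt; rewrite -xsection_slice//; exact: measurable_xsection mE. Qed.

Lemma integral_xsec t (f : T -> \bar R) : level_dom t ->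
  (\int[xsec t]_x f x = \int[vol]_(x in Klev K rho t) f x)%E.
Proof. by move=> Dt; rewrite integral_mrestr xsection_slice. Qed.

Lemma xsec_mass t : level_dom t -> xsec t setT = vol (Klev K rho t).
Proof. by move=> Dt; rewrite /xsec_restr /= /mrestr setTI xsection_slice. Qed.

Lemma xsec_mass0 t A : ~ level_dom t -> xsec t A = 0%E.
Proof. by move=> Dt; rewrite /xsec_restr /= /mrestr xsection_slice0// setI0 measure0. Qed.

Lemma xsec_fin t : (xsec t setT < +oo)%E.
Proof.
have [Dt|Dt] := pselect (level_dom t); last by rewrite xsec_mass0// ltry.
by rewrite xsec_mass//; case: (levels Dt.1 Dt.2).
Qed.

Lemma ysection_slice0 x : ~ K x -> ysection slice_set x = set0.
Proof.
by move=> Kx; apply/seteqP; split => t; rewrite /ysection //= inE /slice_set /= => -[].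
Qed.

(** The section above [x] contains the endpoint [rho x] or not, according to whether [rho x] is an
    admissible level. Removing this null point leaves the open interval of the samplers in either
    case. *)
Lemma integral_ysec x (g : R -> \bar R) : K x -> measurable_fun setT g ->
  (\int[ysec x]_t g t = \int[leb]_(t in [set t : R | (0 < t < rho x)%R]) g t)%E.
Proof.
move=> Kx mg; rewrite integral_mrestr.
have A : [set t : R | 0 < t < rho x] = ysection slice_set x `\ rho x.
  apply/seteqP; split => t; rewrite /ysection /= inE /slice_set /=.
    move=> /andP[t0 tr]; split; last by apply/eqP; rewrite lt_eqF.
    split=> //; first exact: ltW.
    by split=> //; apply: lt_le_trans (rho_le_sup Kx); rewrite lte_fin.
  by move=> [[_ tr [t0 _]] /eqP tn]; rewrite t0 lt_neqAle tn tr.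
have mA : measurable (ysection slice_set x `\ rho x).
  by apply: measurableD; [exact: measurable_ysection mE|exact: measurable_set1].
by rewrite A integral_setD1//; exact: measurable_funTS.
Qed.

Lemma ysec_mass x : K x -> ysec x setT = (rho x)%:E.
Proof.
move=> Kx; have := @integral_ysec x (cst 1%E) Kx (measurable_cst _).
have -> : [set t : R | 0 < t < rho x] = [set` `]0, rho x[].
  by apply/seteqP; split => t /=; rewrite in_itv.
rewrite !integral_cst// !mul1e => ->.
rewrite [LHS](lebesgue_measure_itv `]0, rho x[)/= lte_fin.
case: ifPn => [_|]; first by rewrite sube0.
by rewrite -leNgt => r0; congr EFin; apply: le_anti; rewrite r0 rho0.
Qed.

Lemma ysec_mass0 x : ~ K x -> ysec x setT = 0%E.
Proof. by move=> Kx; rewrite /ysec_restr /= /mrestr ysection_slice0// setI0 measure0. Qed.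

Lemma ysec_fin x : (ysec x setT < +oo)%E.
Proof.
by have [Kx|Kx] := pselect (K x); [rewrite ysec_mass// ltry|rewrite ysec_mass0// ltry].
Qed.

Lemma integral_slice_base (f : T -> R) : measurable_fun setT f ->
  (forall x, 0 <= f x) ->
  (\int[M]_p (f p.2)%:E = \int[vol]_(x in K) (f x * rho x)%:E)%E.
Proof.
move=> mf f0; rewrite (integral_base leb vol mE (f := EFin \o f)); first last.
- by move=> x; rewrite lee_fin.
- exact/measurable_EFinP.
rewrite [RHS]integral_mkcond; apply: eq_integral => x _.
rewrite patchE; case: ifPn => [/[!inE] Kx|/negP Kx]; first by rewrite ysec_mass.
by rewrite ysec_mass0 ?mule0// => Kx'; apply: Kx; rewrite inE.
Qed.

Lemma slice_mass : M setT = Zrho vol K rho.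
Proof.
have := @integral_slice_base (cst 1) (measurable_cst _) (fun=> ler01).
rewrite (integral_cst _ measurableT 1%:E) mul1e => ->.
by apply: eq_integral => x _; rewrite mul1r.
Qed.

Lemma slice_fin : (M setT < +oo)%E. Proof. by rewrite slice_mass. Qed.

Lemma ip_slice1 : ip M (cst 1) (cst 1) = fine (Zrho vol K rho).
Proof.
rewrite /ip; under eq_Rintegral do rewrite /= mulr1.
by rewrite Rintegral_cst// mul1r slice_mass.
Qed.

Lemma slice_pos : 0 < ip M (cst 1) (cst 1).
Proof. by rewrite ip_slice1 fine_gt0// Zpos Zfin. Qed.

(** Outside [K] the function [f] is arbitrary; extending it by 0 makes the lift measurable on the
    whole product. *)
Definition hat (f : T -> R) : R * T -> R := (ext0 K f) \o snd.

Lemma normsq_pi_eq (f g : T -> R) : (forall x, K x -> f x = g x) ->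
  normsq_pi vol K rho f = normsq_pi vol K rho g.
Proof.
move=> fg; rewrite /normsq_pi; congr (_ * _)%E.
by apply: eq_integral => x /[!inE] /fg ->.
Qed.

Lemma normsq_piE (f : T -> R) : measurable_fun setT f ->
  normsq_pi vol K rho f =
  ((\int[M]_p ((f \o snd) p ^+ 2)%:E) * ((fine (Zrho vol K rho))^-1)%:E)%E.
Proof.
move=> mf; rewrite (integral_slice_base (f := fun x => f x ^+ 2))//.
- exact: measurable_funX.
- by move=> x; exact: sqr_ge0.
Qed.

Let Z := fine (Zrho vol K rho).
Let Z0 : 0 < Z. Proof. by rewrite /Z -ip_slice1 slice_pos. Qed.

Lemma normsq_pi_ip (f : T -> R) : L2 M (f \o snd) -> measurable_fun setT f ->
  normsq_pi vol K rho f = (ip M (f \o snd) (f \o snd) / Z)%:E.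
Proof.
by move=> Lf mf; rewrite normsq_piE// EFinM ipE.
Qed.

Lemma L2pi_hat f : L2pi vol K rho f -> L2 M (hat f).
Proof.
move=> [mf f2]; have mh := measurable_ext0 mK mf; split.
  by apply: measurableT_comp => //; exact: measurable_snd.
move: f2; rewrite (@normsq_pi_eq f (ext0 K f)); last by move=> x Kx; rewrite ext0T.
rewrite normsq_piE// => lt.
rewrite ltNge leye_eq; apply/negP => /eqP e.
by move: lt; rewrite e gt0_mulye ?ltxx// lte_fin invr_gt0.
Qed.

Lemma hat_L2pi (g : T -> R) : measurable_fun setT g -> L2 M (g \o snd) ->
  L2pi vol K rho g.
Proof.
move=> mg Lg; split; first exact: measurable_funTS.
by rewrite normsq_pi_ip// ltry.
Qed.

Lemma Sop_ip f : L2pi vol K rho f ->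
  Sop vol K rho f = fun=> ip M (hat f) (cst 1) / ip M (cst 1) (cst 1).
Proof.
move=> Lf; have Lh := L2pi_hat Lf; apply/funext => x.
rewrite /Sop ip_slice1; congr (_ / _).
rewrite /ip; under eq_Rintegral do rewrite /= mulr1.
rewrite /Rintegral; congr fine.
rewrite (fubini_ysec (L2_integrable slice_fin Lh)).
rewrite [LHS]integral_mkcond; apply: eq_integral => y _.
rewrite patchE /hat /= (integral_cst _ measurableT (ext0 K f y)%:E).
case: ifPn => [/[!inE] Ky|/negP Ky]; first by rewrite ysec_mass// ext0T.
by rewrite ysec_mass0 ?mule0// => Ky'; apply: Ky; rewrite inE.
Qed.

End slice_space.

(** * Norm of a sampler minus [S] in terms of its centered form *)

Lemma ip_scale d (X : measurableType d) (R : realType)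
    (mu : {measure set X -> \bar R}) c (f : X -> R) : L2 mu f ->
  ip mu (lincomb c f (cst 0)) (lincomb c f (cst 0)) = c ^+ 2 * ip mu f f.
Proof.
move=> Lf; rewrite /ip -RintegralZl//; last exact: L2_integrable_mul.
by apply: eq_Rintegral => x _; rewrite /lincomb /=; ring.
Qed.

Lemma centered_formZ d (X : measurableType d) (R : realType)
    (mu : {measure set X -> \bar R}) (P : (X -> R) -> X -> R) c (f : X -> R) :
  (mu setT < +oo)%E -> sym_op mu P -> L2 mu f ->
  centered_form mu P (lincomb c f (cst 0)) (lincomb c f (cst 0)) =
  c ^+ 2 * centered_form mu P f f.
Proof.
move=> mufin [LP Plin PC] Lf; have L0 := L2_cst mufin 0.
have Lc := L2_lincomb c Lf L0; have L1 := L2_cst mufin 1.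
(* As [0 = -1 * 0 + 0], weak linearity gives [ip (P 0) h = - ip (P 0) h + ip (P 0) h = 0], although
   [P 0] itself is not known to be the zero function. *)
have zero : lincomb (-1) (cst 0) (cst 0) = (cst 0 : X -> R).
  by apply/funext => x; rewrite /lincomb mulr0 addr0.
have ip0 h : L2 mu h -> ip mu (cst 0) h = 0.
  by move=> Lh; have := ip_lincombl (-1) L0 L0 Lh; rewrite zero; lra.
have P0 h : L2 mu h -> ip mu (P (cst 0)) h = 0.
  by move=> Lh; have := Plin (-1) _ _ _ L0 L0 Lh; rewrite zero; lra.
rewrite /centered_form Plin// !ip_lincombl// P0// ip0// ip_lincombr//; last exact: LP.
by rewrite (ipC _ _ (cst 0)) ip0//; [ring|exact: LP].
Qed.

Section slice_norms.
Context (R : realType) (d : nat).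
Local Notation T := (d.-tuple R).
Local Notation leb := (@lebesgue_measure R).
Variables (vol : {sigma_finite_measure set T -> \bar R}) (K : set T) (rho : T -> R).
Hypotheses (mK : measurable K) (mrho : measurable_fun K rho)
  (rho0 : forall x, K x -> 0 <= rho x)
  (Zpos : (0 < Zrho vol K rho)%E) (Zfin : (Zrho vol K rho < +oo)%E).
Local Notation mE := (measurable_slice_set mK mrho).
Local Notation M := (slice_measure vol mK mrho).
Let Mfin := slice_fin mK mrho rho0 Zfin.
Let ysecfin := ysec_fin mK mrho rho0.
Let Mpos := slice_pos mK mrho rho0 Zpos Zfin.

Variables (A : (T -> R) -> T -> R) (P : (R * T -> R) -> R * T -> R).
Hypothesis symP : sym_op M P.
Hypothesis AP : forall f, L2pi vol K rho f -> forall x, K x ->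
  A f x = fibre_avg leb mE (P (hat K f)) x.

Local Notation dev := (deviation leb vol mE P).
Let AS := fun f x => A f x - Sop vol K rho f x.

Let measurable_dev f : L2pi vol K rho f -> measurable_fun setT (dev (ext0 K f)).
Proof.
move=> Lf; apply: measurable_funB; last exact: measurable_cst.
apply: measurable_fibre_avg; case: symP => LP _ _.
by case: (LP _ (L2pi_hat mK mrho rho0 Zpos Zfin Lf)).
Qed.

Let normsq_AS f : L2pi vol K rho f ->
  normsq_pi vol K rho (AS f) =
  (ip M (dev (ext0 K f) \o snd) (dev (ext0 K f) \o snd) / ip M (cst 1) (cst 1))%:E.
Proof.
move=> Lf; have Lh := L2pi_hat mK mrho rho0 Zpos Zfin Lf.
rewrite (@normsq_pi_eq _ _ _ _ _ _ (dev (ext0 K f))); last first.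
  by move=> x Kx; rewrite /AS (Sop_ip mK mrho rho0 Zpos Zfin Lf) AP.
rewrite (@normsq_pi_ip _ _ _ _ _ mK mrho)//; last exact: measurable_dev.
  by rewrite ip_slice1.
exact: (L2_deviation Mfin ysecfin symP Lh).
Qed.

Let normsq_hat f : L2pi vol K rho f ->
  normsq_pi vol K rho f = (ip M (hat K f) (hat K f) / ip M (cst 1) (cst 1))%:E.
Proof.
move=> Lf; have Lh := L2pi_hat mK mrho rho0 Zpos Zfin Lf.
rewrite (@normsq_pi_eq _ _ _ _ _ _ (ext0 K f)); last first.
  by move=> x Kx; rewrite ext0T.
rewrite (@normsq_pi_ip _ _ _ _ _ mK mrho)//; first by rewrite ip_slice1.
by case: Lf => mf _; exact: measurable_ext0.
Qed.

Lemma opnorm_pi_ge0 (B : (T -> R) -> T -> R) : (0 <= opnorm_pi vol K rho B)%E.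
Proof.
apply: le_trans (ereal_sup_ubound _); last first.
  exists (cst 0); last reflexivity.
  have n0 : normsq_pi vol K rho (cst 0) = 0%E.
    rewrite /normsq_pi integral0_eq ?mul0e// => x _.
    by rewrite expr0n mul0r.
  by split; rewrite ?n0//; split; rewrite ?n0// ltry.
by case: (normsq_pi _ _ _ _) => [r| |] //=; rewrite lee_fin sqrtr_ge0.
Qed.

Lemma opnorm_pi_le c : 0 <= c ->
  (forall F, L2 M F -> 0 <= centered_form M P F F) ->
  (forall f, L2pi vol K rho f ->
     centered_form M P (hat K f) (hat K f) <= c * ip M (hat K f) (hat K f)) ->
  (opnorm_pi vol K rho AS <= c%:E)%E.
Proof.
move=> c0 q0 qc; apply: ge_ereal_sup => _ [f [Lf f1] <-].
have Lh := L2pi_hat mK mrho rho0 Zpos Zfin Lf.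
pose a := ext0 K (dev (ext0 K f)).
have Ldev := L2_deviation Mfin ysecfin symP Lh.
have mdev := measurable_dev Lf.
have Ldevpi : L2pi vol K rho (dev (ext0 K f)) by exact: (hat_L2pi rho0 mdev Ldev).
have La : L2 M (a \o snd) by exact: (L2pi_hat mK mrho rho0 Zpos Zfin Ldevpi).
have le : ip M (dev (ext0 K f) \o snd) (dev (ext0 K f) \o snd) <=
          c ^+ 2 * ip M (hat K f) (hat K f).
  apply: (deviation_le Mfin ysecfin symP c0 q0 Lh La).
    by move=> [t x] [Kx _ _] /=; rewrite /a ext0T.
  by move=> g [->|->]; exact: qc.
rewrite normsq_AS//= lee_fin -[leRHS](ger0_norm c0) -sqrtr_sqr; apply: ler_wsqrtr.
move: f1; rewrite normsq_hat// lee_fin !ler_pdivrMr// mul1r => f1.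
by apply: (le_trans le); rewrite ler_wpM2l// sqr_ge0.
Qed.

(** The norm is a supremum over the unit ball, so [f] is first rescaled to norm 1; if [f] has norm
    0, its centered form vanishes by Cauchy-Schwarz. *)
Lemma le_opnorm_pi h f : opnorm_pi vol K rho AS = h%:E -> L2pi vol K rho f ->
  centered_form M P (hat K f) (hat K f) <= h * ip M (hat K f) (hat K f).
Proof.
move=> hE Lf; have Lh := L2pi_hat mK mrho rho0 Zpos Zfin Lf.
have h0 : 0 <= h by rewrite -lee_fin -hE; exact: opnorm_pi_ge0.
have n0 := ip_ge0 M (hat K f).
have [nE|nn0] := eqVneq (ip M (hat K f) (hat K f)) 0.
  rewrite nE mulr0 -ip_deviation//.
  have := semi_inner_cauchy_schwarz (semi_inner_ip M)
    (L2_deviation Mfin ysecfin symP Lh) Lh.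
  by rewrite nE mulr0; set q := ip _ _ _ => q2; nra.
have np : 0 < ip M (hat K f) (hat K f) by rewrite lt_neqAle eq_sym nn0.
(* The norm of L_2(pi) divides by the mass of [M], so unit norm means that [c * f] has the same
   square integral over [M] as the constant 1. *)
pose c := Num.sqrt (ip M (cst 1) (cst 1) / ip M (hat K f) (hat K f)).
have c2 : c ^+ 2 = ip M (cst 1) (cst 1) / ip M (hat K f) (hat K f).
  by rewrite sqr_sqrtr// divr_ge0// ltW.
have cp : 0 < c ^+ 2 by rewrite c2 divr_gt0.
pose g : T -> R := fun x => c * ext0 K f x.
have gE : hat K g = lincomb c (hat K f) (cst 0).
  apply/funext => -[t x]; rewrite /hat /lincomb /= addr0 /g /ext0 /patch /=.
  by case: (x \in K); rewrite ?mulr0.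
have mg : measurable_fun setT g.
  apply: measurable_funM => //; case: Lf => mf _; exact: measurable_ext0.
have Lg : L2pi vol K rho g.
  apply: (@hat_L2pi _ _ _ _ _ mK mrho) => //.
  have := L2_lincomb c Lh (L2_cst Mfin 0); congr L2.
  by apply/funext => -[t x]; rewrite /lincomb /= addr0.
have ipg : ip M (hat K g) (hat K g) = ip M (cst 1) (cst 1).
  by rewrite gE ip_scale// c2 divfK.
have Lhg := L2pi_hat mK mrho rho0 Zpos Zfin Lg.
have : centered_form M P (hat K g) (hat K g) <= h * ip M (hat K g) (hat K g).
  apply: (centered_le_deviation Mfin ysecfin symP h0 Lhg).
  have : (esqrt (normsq_pi vol K rho (AS g)) <= h%:E)%E.
    rewrite -hE; apply: ereal_sup_ubound; exists g => //; split=> //.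
    by rewrite normsq_hat// ipg divff// gt_eqF.
  rewrite normsq_AS//= lee_fin -[leRHS](ger0_norm h0) -sqrtr_sqr ler_sqrt ?sqr_ge0//.
  by rewrite ler_pdivrMr// ipg.
by rewrite gE centered_formZ// ip_scale// mulrCA ler_pM2l.
Qed.

End slice_norms.

(** * The hybrid and the simple sampler as averaged fibrewise operators *)

Lemma L2_xsec_ae d1 d2 (T1 : measurableType d1) (T2 : measurableType d2)
    (R : realType) (m1 : {sigma_finite_measure set T1 -> \bar R})
    (m2 : {sigma_finite_measure set T2 -> \bar R}) (E : set (T1 * T2))
    (mE : measurable E) (F : T1 * T2 -> R) : L2 (prod_restr m1 m2 mE) F ->
  {ae m1, forall t, L2 (xsec_restr m2 mE t) (fun x => F (t, x))}.
Proof.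
move=> [mF F2]; have m2F := measurable_EFin_sqr mF.
have F20 p : (0 <= (F p ^+ 2)%:E)%E by rewrite lee_fin sqr_ge0.
have : m1.-integrable setT (fun t => \int[xsec_restr m2 mE t]_x (F (t, x) ^+ 2)%:E)%E.
  apply/integrableP; split; first exact: (measurable_integral_xsec_restr m2 mE m2F).
  under eq_integral do rewrite gee0_abs ?integral_ge0//.
  by rewrite -(tonelli_xsec m1 m2 mE m2F).
move=> /(integrable_ae measurableT); apply: filterS => t /= /(_ Logic.I) fx.
split; first exact: measurable_fun_pair2.
by rewrite -ge0_fin_numE// integral_ge0.
Qed.

Lemma kop_iter_contraction d (X : measurableType d) (R : realType)
    (mu : {measure set X -> \bar R}) (kap : X -> {measure set X -> \bar R})
    k (f : X -> R) : reversible_kernel mu kap -> measurable_fun setT f ->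
  measurable_fun setT (iter k (kop kap) f) /\
  (\int[mu]_x (iter k (kop kap) f x ^+ 2)%:E <= \int[mu]_x (f x ^+ 2)%:E)%E.
Proof.
move=> rev mf; elim: k => //= k [mk le]; split; first exact: (measurable_kop rev mk).
exact: le_trans (kop_contraction rev mk) le.
Qed.

Section hybrid.
Context (R : realType) (d : nat).
Local Notation T := (d.-tuple R).
Local Notation leb := (@lebesgue_measure R).
Variables (vol : {sigma_finite_measure set T -> \bar R}) (K : set T) (rho : T -> R)
  (H : R -> T -> {measure set T -> \bar R}).
Hypotheses (mK : measurable K) (mrho : measurable_fun K rho)
  (rho0 : forall x, K x -> 0 <= rho x)
  (Zpos : (0 < Zrho vol K rho)%E) (Zfin : (Zrho vol K rho < +oo)%E)
  (levels : forall t, 0 < t -> (t%:E < rho_sup K rho)%E ->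
     (0 < vol (Klev K rho t))%E /\ (vol (Klev K rho t) < +oo)%E)
  (Hmarkov : forall t x, 0 < t -> (t%:E < rho_sup K rho)%E -> Klev K rho t x ->
     H t x setT = 1%E /\ H t x (~` Klev K rho t) = 0%E)
  (Hout : forall t x, 0 < t -> (t%:E < rho_sup K rho)%E -> ~ Klev K rho t x ->
     H t x setT = 0%E)
  (Hmeas : forall A, measurable A ->
     measurable_fun [set p : R * T | 0 < p.1 /\ (p.1%:E < rho_sup K rho)%E]
       (fun p : R * T => (H p.1 p.2 A : \bar R)))
  (Hrev : forall t, 0 < t -> (t%:E < rho_sup K rho)%E ->
     forall A B, measurable A -> measurable B ->
       (\int[vol]_(x in Klev K rho t `&` A) H t x B =
        \int[vol]_(x in Klev K rho t `&` B) H t x A)%E)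
  (Hpsd : ell_ae vol K rho (fun t => psd_t vol K rho H t)).

Local Notation mE := (measurable_slice_set mK mrho).
Local Notation M := (slice_measure vol mK mrho).
Local Notation xsec := (xsec_restr vol mE).
Local Notation ysec := (ysec_restr leb mE).
Local Notation lev := (level_dom K rho).
Let Mfin := slice_fin mK mrho rho0 Zfin.
Let ysecfin := ysec_fin mK mrho rho0.
Let xsecfin := xsec_fin mK mrho levels.
Let Mpos := slice_pos mK mrho rho0 Zpos Zfin.

(** At other levels nothing is known of [H], not even measurability, so it is replaced by the zero
    measure; the region under the graph has no points there. *)
Definition hybrid_family (p : R * T) : {measure set T -> \bar R} :=
  if `[< lev p.1 >] then H p.1 p.2 else mzero.

Local Notation unif := (unif_family vol mE).
Local Notation P := (fibre_op hybrid_family).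
Local Notation U := (fibre_op unif).

Lemma hybrid_familyE t : lev t -> (fun x => hybrid_family (t, x)) = H t.
Proof. by move=> Dt; apply/funext => x; rewrite /hybrid_family asboolT. Qed.

Lemma kernel_family_hybrid : kernel_family vol mE hybrid_family.
Proof.
split.
- move=> A mA.
  rewrite (_ : (fun p => _) = (fun p : R * T => H p.1 p.2 A) \_
    [set p : R * T | 0 < p.1 /\ (p.1%:E < rho_sup K rho)%E]); last first.
    apply/funext => p; rewrite /hybrid_family /patch.
    case: asboolP => Dp; first by rewrite mem_set.
    by rewrite memNset.
  have mD : measurable [set p : R * T | 0 < p.1 /\ (p.1%:E < rho_sup K rho)%E].
    rewrite (_ : [set p | _] = setT `&` (fst @^-1` lev)) ?setTI//.
    rewrite -[X in measurable X]setTI; apply: measurable_fst => //.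
    exact: measurable_level_dom.
  exact: (proj1 (measurable_restrictT _ mD) (Hmeas mA)).
- move=> [t x]; rewrite /hybrid_family /=; case: asboolP => [[t0 ts]|_]; last exact: lee01.
  have [Kx|Kx] := pselect (Klev K rho t x); first by have [-> _] := Hmarkov t0 ts Kx.
  by rewrite (Hout t0 ts Kx).
- move=> t A B mA mB; have [Dt|Dt] := pselect (lev t); last first.
    by rewrite [LHS]integral_mkcond [RHS]integral_mkcond !integral_mrestr
      xsection_slice0// !integral_set0.
  rewrite [LHS]integral_mkcond [RHS]integral_mkcond !(integral_xsec _ _ _ _ Dt).
  rewrite -!integral_mkcondr.
  have := Hrev Dt.1 Dt.2 mA mB.
  by rewrite /hybrid_family/= asboolT.
Qed.
Let famH := kernel_family_hybrid.
Let famU := kernel_family_unif xsecfin.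
Let symH : sym_op M P.
Proof. exact: (@sym_op_fibre _ _ _ _ _ leb vol _ mE _ famH). Qed.
Let symU : sym_op M U.
Proof. exact: (@sym_op_fibre _ _ _ _ _ leb vol _ mE _ famU). Qed.

Let mP F : measurable_fun setT F -> measurable_fun setT (P F).
Proof. exact: (@measurable_fibre_op _ _ _ _ _ leb vol _ mE _ _ famH). Qed.
Let mU F : measurable_fun setT F -> measurable_fun setT (U F).
Proof. exact: (@measurable_fibre_op _ _ _ _ _ leb vol _ mE _ _ famU). Qed.

(** [H t x] gives no mass to the complement of [K(t)], hence none to that of [K], where [f] is
    arbitrary. *)
Lemma Hop_ext0 t x f : lev t -> Klev K rho t x -> Hop H t f x = Hop H t (ext0 K f) x.
Proof.
move=> [t0 ts] Kx; rewrite /Hop; congr fine.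
have [_ HK] := Hmarkov t0 ts Kx.
have KC : H t x (~` K) = 0%E.
  apply/eqP; rewrite eq_le measure_ge0 andbT -HK.
  apply: le_measure; rewrite ?inE; try exact: measurableC.
    by apply: measurableC; exact: (measurable_Klev mK mrho).
  by apply: subsetC => y [].
rewrite [LHS](integral_concentrated _ mK KC) [RHS](integral_concentrated _ mK KC).
by apply: eq_integral => y /[!inE] Ky; rewrite ext0T.
Qed.

Let measurable_hat f : L2pi vol K rho f -> measurable_fun setT (hat K f).
Proof. by move=> Lf; case: (L2pi_hat mK mrho rho0 Zpos Zfin Lf). Qed.

Let slice_lev x t : K x -> 0 < t < rho x -> lev t /\ Klev K rho t x.
Proof.
move=> Kx /andP[t0 tr]; split; last by split=> //; exact: ltW.
by split=> //; apply: lt_le_trans (rho_le_sup rho Kx); rewrite lte_fin.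
Qed.

Let fibre_avgE G x : measurable_fun setT G -> K x -> fibre_avg leb mE G x =
  fine (\int[leb]_(t in [set s : R | (0 < s < rho x)%R]) (G (t, x))%:E)%E / rho x.
Proof.
move=> mG Kx; rewrite /fibre_avg ysec_mass//= integral_ysec//.
by apply/measurable_EFinP; exact: (measurable_fun_pair1 x mG).
Qed.

Lemma Hslice_fibre_avg f : L2pi vol K rho f -> forall x, K x ->
  Hslice rho H f x = fibre_avg leb mE (P (hat K f)) x.
Proof.
move=> Lf x Kx; rewrite fibre_avgE//; last first.
  exact: (mP (measurable_hat Lf)).
rewrite /Hslice; congr (fine _ / _); apply: eq_integral => t /[!inE] tx.
have [Dt Kt] := slice_lev Kx tx; congr EFin.
by rewrite (Hop_ext0 _ Dt Kt) /fibre_op /= hybrid_familyE.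
Qed.

Lemma unif_opE F t x : measurable_fun setT F -> lev t ->
  U F (t, x) = Ut vol K rho t (fun y => F (t, y)).
Proof.
move=> mF Dt; rewrite fibre_op_unif// /Ut.
by rewrite integral_xsec// xsec_mass.
Qed.

Lemma Uslice_fibre_avg f : L2pi vol K rho f -> forall x, K x ->
  Uslice vol K rho f x = fibre_avg leb mE (U (hat K f)) x.
Proof.
move=> Lf x Kx; have mh := measurable_hat Lf.
rewrite fibre_avgE//; last exact: mU.
rewrite /Uslice; congr (fine _ / _); apply: eq_integral => t /[!inE] tx.
have [Dt Kt] := slice_lev Kx tx; congr EFin.
rewrite unif_opE// /Ut; congr (fine _ / _); apply: eq_integral => y /[!inE] -[Ky _].
by rewrite /hat /= ext0T.
Qed.

Let volE t : lev t -> fine (vol (Klev K rho t)) != 0.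
Proof.
move=> [t0 ts]; have [v0 vfin] := levels t0 ts.
by rewrite gt_eqF// fine_gt0// v0.
Qed.

Let Ut_cst t c : lev t -> Ut vol K rho t (fun=> c) = c.
Proof.
move=> Dt; have [v0 vfin] := levels Dt.1 Dt.2; rewrite /Ut.
rewrite (integral_cst _ (measurable_Klev mK mrho Dt) c%:E) fineM//=; first last.
  by rewrite ge0_fin_numE.
by rewrite mulfK// volE.
Qed.

Lemma unif_idem F G : L2 M F -> L2 M G -> ip M (U (U F)) G = ip M (U F) G.
Proof.
move=> [mF _] _; apply: eq_ip_on => -[t x] [Kx tx Dt] /=.
have mUF := mU mF.
rewrite unif_opE//; under eq_fun do rewrite unif_opE//.
by rewrite Ut_cst// unif_opE.
Qed.

(** At a fixed level [U F] is constant, and [H_t] has mass 1 from each point of [K(t)]. *)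
Lemma hybrid_unif F G : L2 M F -> L2 M G -> ip M (P (U F)) G = ip M (U F) G.
Proof.
move=> [mF _] _; apply: eq_ip_on => -[t x] [Kx tx Dt] /=.
rewrite {1}/fibre_op /= hybrid_familyE// /kop.
under eq_integral do rewrite unif_opE//.
have [H1 _] : H t x setT = 1%E /\ _ := Hmarkov Dt.1 Dt.2 (conj Kx tx).
by rewrite (integral_cst _ measurableT (Ut _ _ _ _ _)%:E) H1 mule1 unif_opE.
Qed.

Lemma unif_mean F : L2 M F -> ip M (U F) (cst 1) = ip M F (cst 1).
Proof.
move=> LF; have L1 := L2_cst Mfin 1.
case: (symU) => _ _ ->//; rewrite [RHS]ipC; apply: eq_ip_on => -[t x] [Kx tx Dt] /=.
by rewrite unif_opE// Ut_cst.
Qed.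

(** The density [vol (K(t))] of [ell] is positive at admissible levels, so an [ell]-null set of such
    levels is null for Lebesgue measure. *)
Lemma psd_ae : {ae leb, forall t, lev t -> psd_t vol K rho H t}.
Proof.
case: Hpsd => N [mN N0 N1 N2].
have mv : measurable_fun setT (fun s => vol (Klev K rho s)).
  have := measurable_fun_xsection vol (measurable_under_graph mK mrho).
  congr measurable_fun; apply/funext => s /=; congr (vol _).
  by apply/seteqP; split => y; rewrite /xsection /= inE.
have : (\int[leb]_(s in N) `|vol (Klev K rho s)| = 0)%E.
  by rewrite -[RHS]N1; apply: eq_integral => s _; rewrite gee0_abs.
move=> /(ae_eq_integral_abs leb mN (measurable_funTS mv)).
apply: filterS => t /= tN Dt; apply: contrapT => nP.
have Nt : N t by apply: N2; split=> //; exact: ltW Dt.1.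
by have [+ _] := levels Dt.1 Dt.2; rewrite tN// ltxx.
Qed.

Lemma psd_hybrid : psd_op M P.
Proof.
move=> F LF; have LP : L2 M (P F) by case: symH => + _ _; apply.
have iPF := L2_integrable_mul LP LF.
rewrite -lee_fin ipE// (fubini_xsec iPF).
have mg := measurable_fubini_xsec iPF.
set g := (fun t => _) in mg.
(* The integrals over the levels are known to be nonnegative for almost every [t] only; passing to
   the absolute value makes positivity hold everywhere without changing the outer integral. *)
rewrite (_ : \int[_]_t _ = \int[leb]_t `|g t|)%E; first exact: integral_ge0.
apply: ae_eq_integral => //; first exact: measurableT_comp.
have aeL : {ae leb, forall t, L2 (xsec t) (fun x => F (t, x))}.
  exact: (@L2_xsec_ae _ _ _ _ _ leb vol _ mE F LF).
have FL : Filter (almost_everywhere leb) by exact: ae_filter_ringOfSetsType.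
apply: (@filterS2 _ _ FL _ _ _ _ psd_ae aeL) => t psdt Lt _ /=.
rewrite gee0_abs// /g; have [Dt|Dt] := pselect (lev t); last first.
  by rewrite integral_mrestr xsection_slice0// integral_set0.
have [v0 vfin] := levels Dt.1 Dt.2.
have ip : (0 < (fine (vol (Klev K rho t)))^-1)%R by rewrite invr_gt0 fine_gt0// v0.
have Ltt : L2t vol K rho t (fun x => F (t, x)).
  case: Lt => mFt Ft; split; first exact: measurable_funTS.
  rewrite /normsq_t -(integral_xsec vol mK mrho)//.
  have fin : (\int[xsec t]_x (F (t, x) ^+ 2)%:E)%E \is a fin_num.
    by rewrite ge0_fin_numE// integral_ge0// => x _; rewrite lee_fin sqr_ge0.
  by rewrite -(fineK fin) -EFinM ltry.
have := psdt Dt _ Ltt; rewrite /inner_t -(integral_xsec vol mK mrho)// => ge0.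
rewrite -(@pmule_lge0 _ ((fine (vol (Klev K rho t)))^-1)%:E) ?lte_fin//.
move: ge0; congr (_ <= _ * _)%E; apply: eq_integral => x _ /=.
by rewrite /fibre_op /= hybrid_familyE.
Qed.

(** * Upper bound for the gap of the hybrid sampler *)

Let q0U F : L2 M F -> 0 <= centered_form M U F F.
Proof.
move=> LF; rewrite /centered_form subr_ge0 ler_pdivrMr// -expr2.
exact: (projection_ge_mean Mfin symU unif_idem (unif_mean LF)).
Qed.

Let qUH F : L2 M F -> centered_form M U F F <= centered_form M P F F.
Proof.
move=> LF; rewrite /centered_form lerD2r.
exact: (projection_le symH psd_hybrid symU unif_idem hybrid_unif).
Qed.

Let q0H F : L2 M F -> 0 <= centered_form M P F F.
Proof. by move=> LF; exact: le_trans (q0U LF) (qUH LF). Qed.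

Lemma gap_hybrid_le :
  (gap vol K rho (Hslice rho H) <= gap vol K rho (Uslice vol K rho))%E.
Proof.
rewrite /gap; apply: leeB; first exact: lexx.
have := opnorm_pi_ge0 vol K rho (fun f x => Hslice rho H f x - Sop vol K rho f x).
case hE : (opnorm_pi _ _ _ _) => [h| |] // h0; last by rewrite leey.
apply: (opnorm_pi_le rho0 Zpos Zfin symU Uslice_fibre_avg) => // f Lf.
apply: le_trans (qUH (L2pi_hat mK mrho rho0 Zpos Zfin Lf)) _.
exact: (le_opnorm_pi rho0 Zpos Zfin symH Hslice_fibre_avg hE Lf).
Qed.

(** * Controlling [H_t^k - U_t] through [beta_k] *)

Section beta_bound.
Variables (k : nat) (f : T -> R).
Hypothesis Lf : L2pi vol K rho f.
Local Notation F := (hat K f).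
Local Notation opn t :=
  (opnorm_t vol K rho t (fun f y => iter k (Hop H t) f y - Ut vol K rho t f)).

Let Dl := lincomb (-1) (U F) (iter k P F).
Let LF := L2pi_hat mK mrho rho0 Zpos Zfin Lf.
Let mF := measurable_hat Lf.
Let mDl : measurable_fun setT Dl.
Proof.
apply: measurable_lincomb; first exact: mU.
by elim: k => //= j; exact: mP.
Qed.

Let NN (t : R) := (\int[xsec t]_x (Dl (t, x) ^+ 2)%:E)%E.
Let nn (t : R) := (\int[xsec t]_x (F (t, x) ^+ 2)%:E)%E.
(* Standing in for the squared norm of [H_t^k - U_t], whose measurability in [t]
   is thereby not needed: this quotient is measurable and dominated by it. *)
Let w (t : R) : R := fine (NN t) / fine (nn t).

Let NN0 t : (0 <= NN t)%E.
Proof. by apply: integral_ge0 => x _; rewrite lee_fin sqr_ge0. Qed.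
Let nn0 t : (0 <= nn t)%E.
Proof. by apply: integral_ge0 => x _; rewrite lee_fin sqr_ge0. Qed.
Let w0 t : 0 <= w t.
Proof. by rewrite divr_ge0// fine_ge0. Qed.

(** A crude bound from [(a - b)^2 <= 2 a^2 + 2 b^2] and two contractions. It serves to make [NN t]
    finite when [nn t] is, and zero when [nn t] is. *)
Let NN_le t : (NN t <= 4%:E * nn t)%E.
Proof.
have revH := fam_reversible famH t; have revU := fam_reversible famU t.
have mFt : measurable_fun setT (fun x => F (t, x)) := measurable_fun_pair2 t mF.
have [mk lek] := kop_iter_contraction k revH mFt.
have leU := kop_contraction revU mFt.
have mUt := measurable_kop revU mFt.
apply: (@le_trans _ _ (\int[xsec t]_x (
   2%:E * (iter k (kop (fun x => hybrid_family (t, x))) (fun x => F (t, x)) x ^+ 2)%:E +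
   2%:E * (kop (fun x => unif (t, x)) (fun x => F (t, x)) x ^+ 2)%:E))%E).
  apply: ge0_le_integral_lower => x _; first by rewrite lee_fin sqr_ge0.
  rewrite -!EFinM -EFinD lee_fin /Dl /lincomb iter_fibre_op /fibre_op /=.
  set a := iter _ _ _ _; set b := kop _ _ _.
  by have := sqr_ge0 (a + b); nra.
have m2 (g : T -> R) : measurable_fun setT g ->
    measurable_fun setT (fun x : T => 2%:E * (g x ^+ 2)%:E)%E.
  by move=> mg; apply: measurable_funeM; exact: measurable_EFin_sqr.
have g0 (g : T -> R) x : (0 <= 2%:E * (g x ^+ 2)%:E)%E.
  by rewrite -EFinM lee_fin mulr_ge0// sqr_ge0.
rewrite ge0_integralD//; [|exact: m2..].
rewrite !ge0_integralZl_EFin//; try exact: measurable_EFin_sqr;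
  try by move=> x _; rewrite lee_fin sqr_ge0.
have -> : (4%:E * nn t = 2%:E * nn t + 2%:E * nn t)%E.
  by rewrite -ge0_muleDl ?lee_fin// -EFinD; congr (_%:E * _)%E; ring.
by apply: leeD; apply: lee_wpmul2l => //; rewrite lee_fin.
Qed.

Let NN_w t : (nn t < +oo)%E -> NN t = ((w t)%:E * nn t)%E.
Proof.
move=> nfin; have nf : nn t \is a fin_num by rewrite ge0_fin_numE.
have Nf : NN t \is a fin_num.
  by rewrite ge0_fin_numE//; apply: le_lt_trans (NN_le t) _; rewrite -(fineK nf) -EFinM ltry.
have [n0|n0] := eqVneq (nn t) 0%E.
  by rewrite n0 mule0; apply: le_anti; rewrite NN0 andbT -(mule0 4%:E) -n0.
rewrite -[in RHS](fineK nf) -[LHS](fineK Nf) -EFinM /w divfK//.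
by rewrite fine_eq0.
Qed.

Let opn_ge0 t : (0 <= opn t)%E.
Proof.
apply: le_trans (ereal_sup_ubound _); last first.
  exists (cst 0); last reflexivity.
  have n0 : normsq_t vol K rho t (cst 0) = 0%E.
    by rewrite /normsq_t integral0_eq ?mul0e// => x _; rewrite expr0n.
  by split; rewrite ?n0//; split; rewrite ?n0// ltry.
by case: (normsq_t _ _ _ _ _) => [r| |] //=; rewrite lee_fin sqrtr_ge0.
Qed.

Let iter_HopZ t c (g : T -> R) : lev t -> 0 < c -> measurable_fun setT g ->
  iter k (Hop H t) (fun x => c * g x) = (fun x => c * iter k (Hop H t) g x).
Proof.
move=> Dt c0 mg; have := fam_reversible famH t; rewrite hybrid_familyE// => rev.
elim: k => //= j ->.
have [mj _] := kop_iter_contraction j rev mg.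
exact: kopZ.
Qed.

(** Once [F] at level [t] is scaled to norm 1 in L_{2,t}, the square root of [w t] is the norm of
    its image under [H_t^k - U_t]. *)
Let w_le t : lev t -> ((w t)%:E <= opn t * opn t)%E.
Proof.
move=> Dt; have opp : (0 <= opn t * opn t)%E by rewrite mule_ge0.
(* This case includes an infinite [nn t], which [fine] sends to 0; then [w t = 0] by the convention
   for division. *)
have [n0|n0] := eqVneq (fine (nn t)) 0; first by rewrite /w n0 invr0 mulr0.
have np : 0 < fine (nn t) by rewrite lt_neqAle eq_sym n0 fine_ge0.
have nf : nn t \is a fin_num by move: np; case: (nn t) => //=; rewrite ltxx.
have Nf : NN t \is a fin_num.
  by rewrite ge0_fin_numE//; apply: le_lt_trans (NN_le t) _; rewrite -(fineK nf) -EFinM ltry.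
have [v0 vfin] := levels Dt.1 Dt.2; set v := fine (vol (Klev K rho t)).
have vp : 0 < v by rewrite fine_gt0// v0.
(* The norm of L_{2,t} divides by the volume [v] of the level set, so this factor gives [c * f] norm
   1. *)
pose c := Num.sqrt (v / fine (nn t)).
have cp : 0 < c by rewrite sqrtr_gt0 divr_gt0.
have c2 : c ^+ 2 = v / fine (nn t) by rewrite sqr_sqrtr// ltW// divr_gt0.
have mf : measurable_fun setT (ext0 K f) by case: Lf => *; exact: measurable_ext0.
pose g : T -> R := fun x => c * ext0 K f x.
have mg : measurable_fun setT g by exact: measurable_funM.
have scale (h : T -> R) : measurable_fun setT h ->
    normsq_t vol K rho t (fun x => c * h x) =
    ((c ^+ 2 / v)%:E * \int[xsec t]_x (h x ^+ 2)%:E)%E.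
  move=> mh; rewrite /normsq_t -(integral_xsec vol mK mrho)//.
  under eq_integral do rewrite exprMn EFinM.
  rewrite ge0_integralZl_EFin//; [|by move=> x _; rewrite lee_fin sqr_ge0
    |exact: measurable_EFin_sqr|exact: sqr_ge0].
  by rewrite muleAC -EFinM.
have g1 : normsq_t vol K rho t g = 1%E.
  rewrite scale// -[X in (_ * X)%E]/(nn t) -(fineK nf) -EFinM c2; congr EFin.
  by field; rewrite n0 gt_eqF.
have Dg y : iter k (Hop H t) g y - Ut vol K rho t g = c * Dl (t, y).
  rewrite iter_HopZ// /Dl /lincomb iter_fibre_op hybrid_familyE// unif_opE//.
  rewrite (_ : Ut vol K rho t g = c * Ut vol K rho t (ext0 K f)).
    by rewrite /hat /=; ring.
  rewrite /Ut -!(integral_xsec vol mK mrho)// integralZ_ge0//; last exact: ltW.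
  by rewrite fineZ// mulrA.
have : ((Num.sqrt (w t))%:E <= opn t)%E.
  apply: ereal_sup_ubound; exists g => /=.
    by split; [split; [exact: measurable_funTS|rewrite g1 ltry]|rewrite g1].
  rewrite (_ : (fun y => _) = (fun y => c * Dl (t, y))); last by apply/funext.
  rewrite scale; last exact: measurable_fun_pair2.
  rewrite -[X in (_ * X)%E]/(NN t) -(fineK Nf) -EFinM c2 /=; congr (Num.sqrt _)%:E.
  by rewrite /w; field; rewrite n0 gt_eqF.
move=> sw; rewrite -[w t]sqr_sqrtr// expr2 EFinM.
by apply: lee_pmul; rewrite ?lee_fin ?sqrtr_ge0.
Qed.

Let measurable_w : measurable_fun setT w.
Proof.
have m (G : R * T -> R) : measurable_fun setT G -> measurable_fun setT
    (fun t : R => fine (\int[xsec t]_x (G (t, x) ^+ 2)%:E)%E).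
  move=> mG; apply: (measurableT_comp (fine_measurable measurableT)).
  apply: (measurable_integral_xsec_restr vol mE (measurable_EFin_sqr mG)).
  by move=> p; rewrite lee_fin sqr_ge0.
apply: measurable_funM; first exact: m.
by apply: measurable_funV_ge0 => [|t]; [exact: m|exact: fine_ge0].
Qed.

Let beta_level b x : beta vol K rho H k = b%:E -> K x ->
  (\int[leb]_(t in [set t : R | (0 < t < rho x)%R]) (opn t * opn t) <=
   (b ^+ 2 * rho x)%:E)%E.
Proof.
move=> bE Kx.
set I := (\int[_]_(t in _) _)%E.
have I0 : (0 <= I)%E by apply: integral_ge0 => t _; rewrite mule_ge0.
have Ib : (esqrt (I * ((rho x)^-1)%:E) <= b%:E)%E.
  by rewrite -bE; apply: ereal_sup_ubound; exists x.
have [r0|r0] := eqVneq (rho x) 0.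
  rewrite /I (_ : [set t | _] = set0) ?integral_set0 ?r0 ?mulr0//.
  by apply/seteqP; split => t //= /andP[a b']; have := lt_trans a b'; rewrite ltxx.
have rp : 0 < rho x by rewrite lt_neqAle eq_sym r0 rho0.
case: I I0 Ib => [r| |] //=; last by rewrite gt0_mulye ?lte_fin ?invr_gt0.
rewrite !lee_fin => rr sb; rewrite -ler_pdivrMr//.
have sr0 := sqrtr_ge0 (r / rho x).
have : Num.sqrt (r / rho x) ^+ 2 <= b ^+ 2.
  by rewrite ler_sqr ?nnegrE// (le_trans sr0).
by rewrite sqr_sqrtr// divr_ge0// ltW.
Qed.

(** At almost every level the square integral of [Dl] is [w t] times that of [F]. In the product
    [w t * F ^+ 2] the two factors depend on different variables, so integrating it over [t] first
    leaves [f x ^+ 2] times the integral of [w] over [(0, rho x)], which is at most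
    [b ^+ 2 * rho x]. *)
Lemma beta_bound b : beta vol K rho H k = b%:E ->
  ip M Dl Dl <= b ^+ 2 * ip M F F.
Proof.
move=> bE; have LU : L2 M (U F) by case: symU => + _ _; apply.
have LDl : L2 M Dl by apply: L2_lincomb => //; exact: L2_iter.
have sq G : L2 M G -> (ip M G G)%:E = (\int[M]_p (G p ^+ 2)%:E)%E.
  by move=> LG; rewrite ipE.
have sq0 (G : R * T -> R) p : (0 <= (G p ^+ 2)%:E)%E by rewrite lee_fin sqr_ge0.
have mF2 := measurable_EFin_sqr mF.
have mwF : measurable_fun setT (fun p : R * T => (w p.1)%:E * (F p ^+ 2)%:E)%E.
  apply: emeasurable_funM => //; apply/measurable_EFinP.
  by apply: (measurableT_comp measurable_w); exact: measurable_fst.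
have wF0 (p : R * T) : (0 <= (w p.1)%:E * (F p ^+ 2)%:E)%E.
  by rewrite mule_ge0 ?lee_fin ?sqr_ge0.
rewrite -lee_fin EFinM !sq//.
have -> : (\int[M]_p (Dl p ^+ 2)%:E = \int[M]_p ((w p.1)%:E * (F p ^+ 2)%:E))%E.
  rewrite (tonelli_xsec leb vol mE (measurable_EFin_sqr mDl))//.
  rewrite (tonelli_xsec leb vol mE mwF)//.
  apply: ae_eq_integral => //.
  - exact: (measurable_integral_xsec_restr vol mE (measurable_EFin_sqr mDl)).
  - exact: (measurable_integral_xsec_restr vol mE mwF).
  have aeL : {ae leb, forall t, L2 (xsec t) (fun x => F (t, x))}.
    exact: (@L2_xsec_ae _ _ _ _ _ leb vol _ mE F LF).
  have FL : Filter (almost_everywhere leb) by exact: ae_filter_ringOfSetsType.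
  apply: (@filterS _ _ FL _ _ _ aeL) => t [mFt Ft] _ /=.
  rewrite -/(NN t) NN_w// ge0_integralZl_EFin//; first exact: measurable_EFin_sqr.
rewrite (tonelli_ysec leb vol mE mwF)//.
rewrite -ge0_integralZl_EFin// ?sqr_ge0//.
rewrite (tonelli_ysec leb vol mE (G := fun p => ((b ^+ 2)%:E * (F p ^+ 2)%:E)%E)); first last.
- by move=> p; rewrite mule_ge0// lee_fin sqr_ge0.
- exact: measurable_funeM.
apply: ge0_le_integral_lower => x _; first exact: integral_ge0.
have mwE : measurable_fun setT (fun t => (w t)%:E) by exact/measurable_EFinP.
have [Kx|Kx] := pselect (K x); last first.
  have F0 t : F (t, x) = 0 by rewrite /hat /= /ext0 patchN// notin_setE.
  rewrite !integral0_eq// => t _; by rewrite F0 expr0n mule0.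
rewrite (integral_cst _ measurableT ((b ^+ 2)%:E * (ext0 K f x ^+ 2)%:E)%E) ysec_mass//.
have -> : (\int[ysec x]_t ((w (t, x).1)%:E * (F (t, x) ^+ 2)%:E) =
    (ext0 K f x ^+ 2)%:E * \int[ysec x]_t (w t)%:E)%E.
  rewrite -ge0_integralZl_EFin// ?sqr_ge0//.
  - by apply: eq_integral => t _; rewrite muleC.
  - by move=> t _; rewrite lee_fin.
rewrite -[leRHS]muleA [leRHS]muleCA -[X in (_ <= _ * X)%E]EFinM.
rewrite lee_wpmul2l ?lee_fin ?sqr_ge0//.
rewrite integral_ysec//; apply: le_trans (beta_level bE Kx).
apply: ge0_le_integral_lower => t /= tx; first by rewrite lee_fin.
by apply: w_le; have [] := slice_lev Kx tx.
Qed.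

End beta_bound.

(** * Lower bound for the gap of the hybrid sampler *)

Lemma beta_ge0 k : (0 <= beta vol K rho H k)%E.
Proof.
have [x Kx] : exists x, K x.
  apply: contrapT => nK; have K0 : K = set0.
    by apply/seteqP; split => x // Kx; apply: nK; exists x.
  by move: Zpos; rewrite /Zrho K0 integral_set0 ltxx.
apply: le_trans (ereal_sup_ubound _); last by exists x.
by case: (_ * _)%E => [r| |] //=; rewrite lee_fin sqrtr_ge0.
Qed.

Lemma gap_hybrid_ge k : (0 < k)%N ->
  ((gap vol K rho (Uslice vol K rho) - beta vol K rho H k) * ((k%:R)^-1)%:E
     <= gap vol K rho (Hslice rho H))%E.
Proof.
move=> k0; have kp : 0 < (k%:R^-1 : R) by rewrite invr_gt0 ltr0n.
(* An infinite norm or an infinite [beta_k] makes the left-hand side [-oo], so both may be taken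
   real. *)
have := opnorm_pi_ge0 vol K rho (fun f x => Uslice vol K rho f x - Sop vol K rho f x).
rewrite {1}/gap; case uE : (opnorm_pi _ _ _ _) => [u| |] // u0; last first.
  by rewrite addNye gt0_mulNye ?lte_fin// leNye.
have := beta_ge0 k; case bE : (beta _ _ _ _ _) => [b| |] // b0; last first.
  by rewrite addeNy gt0_mulNye ?lte_fin// leNye.
rewrite !lee_fin in u0 b0.
(* Chosen so that [1 - c] is the claimed lower bound, which becomes [c] as a bound for the norm of
   the hybrid sampler minus [S]. *)
pose c : R := 1 - (1 - u - b) / k%:R.
have qc f : L2pi vol K rho f ->
    centered_form M P (hat K f) (hat K f) <= c * ip M (hat K f) (hat K f).
  move=> Lf; have LF := L2pi_hat mK mrho rho0 Zpos Zfin Lf.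
  have LU : L2 M (U (hat K f)) by case: symU => + _ _; apply.
  have LI : L2 M (iter k P (hat K f)) by exact: L2_iter.
  have LD := L2_lincomb (-1) LU LI.
  have n0 := ip_ge0 M (hat K f).
  have mom := moment_ge symH psd_hybrid k LF.
  have un := le_opnorm_pi rho0 Zpos Zfin symU Uslice_fibre_avg uE Lf.
  have bb := beta_bound Lf bE.
  have cs := semi_inner_cauchy_schwarz (semi_inner_ip M) LD LF.
  have dl : ip M (lincomb (-1) (U (hat K f)) (iter k P (hat K f))) (hat K f) <=
            b * ip M (hat K f) (hat K f).
    set D := ip _ _ _; have [D0|D0] := leP D 0.
      by apply: (le_trans D0); rewrite mulr_ge0.
    rewrite -ler_sqr ?nnegrE ?mulr_ge0//; last exact: ltW.
    by apply: (le_trans cs); rewrite exprMn [X in _ <= _ * X]expr2 mulrA ler_wpM2r.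
  rewrite ip_lincombl// in dl.
  have m0 : 0 <= ip M (hat K f) (cst 1) * ip M (hat K f) (cst 1) / ip M (cst 1) (cst 1).
    by apply: divr_ge0; [rewrite -expr2 sqr_ge0|exact: ltW].
  rewrite /centered_form in un *.
  set m := _ / _ in un m0 *; set a1 := ip M (P _) _ in mom *.
  set a0 := ip M (hat K f) (hat K f) in n0 mom un dl *.
  have k1 : 1 <= k%:R :> R by rewrite ler1n.
  have ck : k%:R * c = k%:R - (1 - u - b) by rewrite /c; field; rewrite gt_eqF// ltr0n.
  (* With [a_k <= <U f, f> + b a0] and [<U f, f> <= u a0 + m], the moment inequality gives
     [k a1 <= k c a0 + m]. Subtracting [k m] proves the claim, since [m >= 0] and [k >= 1]. *)
  rewrite -(@ler_pM2l _ k%:R) ?ltr0n// mulrA ck.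
  by nra.
(* The centered form at the constant 1 is nonnegative and at most [c] times the positive mass of
   [M]. *)
have c0 : 0 <= c.
  pose e : T -> R := cst 1.
  have Le : L2pi vol K rho e.
    apply: (@hat_L2pi _ _ _ _ _ mK mrho) => //; exact: (L2_cst Mfin 1).
  have LE := L2pi_hat mK mrho rho0 Zpos Zfin Le.
  have eE : ip M (hat K e) (hat K e) = ip M (cst 1) (cst 1).
    have E1 h : ip M (hat K e) h = ip M (cst 1) h.
      by apply: eq_ip_on => -[t x] [Kx _ _] /=; rewrite /hat /= ext0T.
    by rewrite E1 ipC E1.
  have := le_trans (q0H LE) (qc _ Le); rewrite eE pmulr_lge0//.
have := opnorm_pi_le rho0 Zpos Zfin symH Hslice_fibre_avg c0 q0H qc.
rewrite /gap; case: (opnorm_pi _ _ _ _) => [h| |] //=; rewrite ?leey//.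
rewrite lee_fin => hc; rewrite -!EFinB -EFinM lee_fin.
by move: hc; rewrite /c; lra.
Qed.

End hybrid.

(** * Sigma-finiteness from the volume of boxes, and the conclusion *)

Lemma lebesgue_Rd_sigma_finite (R : realType) (d : nat)
    (vol : {measure set (d.-tuple R) -> \bar R}) :
  is_lebesgue_Rd vol -> sigma_finite setT vol.
Proof.
move=> vol_box.
pose B n : set (d.-tuple R) :=
  [set x | forall i, tnth [tuple of nseq d (- n%:R)] i < tnth x i
                     <= tnth [tuple of nseq d n%:R] i].
exists B.
  apply/seteqP; split => x // _.
  (* The sum of the absolute values bounds all coordinates at once, so [x] lies in the cube of
     half-side [n]. *)
  have [n xn] : exists n : nat, \sum_(i < d) `|tnth x i| < n%:R.
    by exists (Num.truncn (\sum_(i < d) `|tnth x i|)).+1; rewrite truncnS_gt.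
  exists n => // i; rewrite !tnth_nseq.
  have : `|tnth x i| < n%:R.
    apply: le_lt_trans xn; rewrite (bigD1 i)//= lerDl.
    by apply: sumr_ge0 => j _; exact: normr_ge0.
  by rewrite ltr_norml => /andP[-> /ltW].
move=> n; split; last first.
  rewrite vol_box ?ltry// => i; rewrite !tnth_nseq.
  by apply: (@le_trans _ _ 0); rewrite ?oppr_le0.
rewrite (_ : B n = \bigcap_(i in [set: 'I_d])
    ((fun x : d.-tuple R => tnth x i) @^-1` [set` `]- n%:R, n%:R]])).
  apply: fin_bigcap_measurable => // i _.
  by rewrite -[X in measurable X]setTI; exact: measurable_tnth.
apply/seteqP; split => x Bx i; last first.
  by rewrite !tnth_nseq; have := Bx i Logic.I; rewrite /= in_itv.
by move=> _ /=; rewrite in_itv/=; have := Bx i; rewrite !tnth_nseq.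
Qed.

Theorem theorem3p3 (R : realType) (d : nat)
  (vol : {measure set (d.-tuple R) -> \bar R})
  (K : set (d.-tuple R)) (rho : d.-tuple R -> R)
  (H : R -> d.-tuple R -> {measure set (d.-tuple R) -> \bar R}) :
  (* vol is Lebesgue measure on (Borel sets of) R^d *)
  is_lebesgue_Rd vol ->
  (* K Borel, rho : K -> [0,oo) measurable, 0 < int_K rho < oo *)
  measurable K ->
  measurable_fun K rho ->
  (forall x, K x -> 0 <= rho x) ->
  (0 < Zrho vol K rho)%E -> (Zrho vol K rho < +oo)%E ->
  (* 0 < vol(K(t)) < oo for t in (0, ||rho||_oo) *)
  (forall t, 0 < t -> (t%:E < rho_sup K rho)%E ->
     (0 < vol (Klev K rho t))%E /\ (vol (Klev K rho t) < +oo)%E) ->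
  (* H_t is a Markov kernel on K(t), extended by 0 outside K(t) *)
  (forall t x, 0 < t -> (t%:E < rho_sup K rho)%E -> Klev K rho t x ->
     H t x setT = 1%E /\ H t x (~` Klev K rho t) = 0%E) ->
  (forall t x, 0 < t -> (t%:E < rho_sup K rho)%E -> ~ Klev K rho t x ->
     H t x setT = 0%E) ->
  (* jointly measurable in (t, x) *)
  (forall A, measurable A ->
     measurable_fun [set p : R * d.-tuple R | 0 < p.1 /\ (p.1%:E < rho_sup K rho)%E]
       (fun p : R * d.-tuple R => (H p.1 p.2 A : \bar R))) ->
  (* H_t reversible w.r.t. U_t *)
  (forall t, 0 < t -> (t%:E < rho_sup K rho)%E ->
     forall A B, measurable A -> measurable B ->
       (\int[vol]_(x in Klev K rho t `&` A) H t x B =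
        \int[vol]_(x in Klev K rho t `&` B) H t x A)%E) ->
  (* H_t positive semi-definite for ell-a.e. t *)
  ell_ae vol K rho (fun t => psd_t vol K rho H t) ->
  (* beta_k -> 0 *)
  (beta vol K rho H k @[k --> \oo] --> 0%E) ->
  forall k : nat, (0 < k)%N ->
    ((gap vol K rho (Uslice vol K rho) - beta vol K rho H k) * ((k%:R)^-1)%:E
       <= gap vol K rho (Hslice rho H))%E /\
    (gap vol K rho (Hslice rho H) <= gap vol K rho (Uslice vol K rho))%E.
Proof.
move=> /lebesgue_Rd_sigma_finite vol_sf.
(* Products and Tonelli take a bundled sigma-finite measure, so [vol] is repackaged with this
   structure and replaced throughout. *)
have [svol ->] : exists svol : {sigma_finite_measure set (d.-tuple R) -> \bar R},
    vol = svol :> {measure set (d.-tuple R) -> \bar R}.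
  pose mx1 := isSFinite.Build _ _ _ vol (sfinite_measure_sigma_finite vol_sf).
  pose mx2 := isSigmaFinite.Build _ _ _ vol vol_sf.
  pose svol : {sigma_finite_measure set _ -> \bar R} := HB.pack (Measure.sort vol) mx1 mx2.
  by exists svol; exact: eq_measure.
move=> mK mrho rho0 Zpos Zfin levels Hmarkov Hout Hmeas Hrev Hpsd _ k k0.
by split; [exact: gap_hybrid_ge|exact: gap_hybrid_le].
Qed.
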